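(* Let $a<b$ be real numbers, let $1<\alpha\le 2$, and let $p:[a,b]\to\mathbb{R}$ be a continuous function. If the fractional boundary value problem $$\begin{cases} D^{\alpha}_{a}y(t)+p(t)y(t)=0, \quad a<t<b,\\ I^{2-\alpha}_{a}y(a)-D^{\alpha-1}_{a}y(a)=0, \quad y(b)+D^{\alpha-1}_{a}y(b)=0,\end{cases}$$ has a nontrivial solution $y$, then $$\int_{a}^{b}(s-a)^{\alpha-2}|p(s)|\,ds>\frac{\big[(b-a)^{\alpha-1}+(\alpha-1)(b-a)^{\alpha-2}+\Gamma(\alpha)\big]\Gamma(\alpha)}{\big[(b-a)^{\alpha-1}+\Gamma(\alpha)\big](b-a+\alpha-1)}.$$
   Context: For $\beta>0$ the Riemann-Liouville fractional integral is $I^{\beta}_{a}y(t)=\frac{1}{\Gamma(\beta)}\int_{a}^{t}(t-s)^{\beta-1}y(s)\,ds$, and $I^{0}_{a}$ is the identity. For a positive integer $n$ and $n-1<\beta\le n$, the Riemann-Liouville fractional derivative is $D^{\beta}_{a}y(t)=D^{n}I^{n-\beta}_{a}y(t)$, where $D^{n}$ is the classical $n$-th derivative. A solution is a real-valued function $y$, continuous on $(a,b]$ and Lebesgue integrable on $(a,b)$, for which $D^{\alpha}_{a}y$ exists on $(a,b)$ and the equation and boundary conditions hold. The values $I^{2-\alpha}_{a}y(a)$ and $D^{\alpha-1}_{a}y(a)$ are the limits of $I^{2-\alpha}_{a}y(t)$ and $D^{\alpha-1}_{a}y(t)$ as $t\to a^{+}$, and $D^{\alpha-1}_{a}y(b)$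 is the limit of $D^{\alpha-1}_{a}y(t)$ as $t\to b^{-}$. Nontrivial means not identically zero. *)

(* Defs.v *)
From HB Require Import structures.
From mathcomp Require Import all_boot all_order all_algebra.
From mathcomp Require Import all_classical all_reals all_analysis.

Set Implicit Arguments.
Unset Strict Implicit.
Unset Printing Implicit Defensive.

Import Order.TTheory GRing.Theory Num.Theory.
Import numFieldNormedType.Exports.

Local Open Scope classical_set_scope.
Local Open Scope ring_scope.

Definition Gamma (R : realType) (z : R) : R :=
  \int[lebesgue_measure]_(x in `]0, +oo[) (x `^ (z - 1) * expR (- x)).

(* Only used for 0 <= beta and a < t. *)
Definition RL_integral (R : realType) (a beta : R) (y : R -> R) (t : R) : R :=
  if beta == 0 then y t
  else (Gamma beta)^-1 *
    \int[lebesgue_measure]_(s in `]a, t[) ((t - s) `^ (beta - 1) * y s).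

(* For 0 < beta, the positive integer n such that n - 1 < beta <= n. *)
Definition RL_order (R : realType) (beta : R) : nat := `|Num.ceil beta|%N.

Definition RL_derivative (R : realType) (a beta : R) (y : R -> R) : R -> R :=
  let n := RL_order beta in derive1n n (RL_integral a (n%:R - beta) y).

(* [derive1n] is total, so the existence of the classical n-th derivative on
   ]a, b[ is the derivability there of all the derivatives of order k < n. *)
Definition RL_derivable (R : realType) (a b beta : R) (y : R -> R) : Prop :=
  let n := RL_order beta in
  forall (k : nat) (t : R), (k < n)%N -> t \in `]a, b[ ->
    derivable (derive1n k (RL_integral a (n%:R - beta) y)) t 1.

(* y : R -> R stands for a function on ]a, b]: its values elsewhere are
   irrelevant. *)
Record is_solution (R : realType) (a b alpha : R) (p y : R -> R) : Prop :=
  IsSolution {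
    sol_continuous : {within `]a, b], continuous y};
    sol_integrable : lebesgue_measure.-integrable `]a, b[ (EFin \o y);
    sol_derivable : RL_derivable a b alpha y;
    sol_equation : forall t : R, t \in `]a, b[ ->
      RL_derivative a alpha y t + p t * y t = 0;
    sol_boundary_a : exists Ia Da : R,
      [/\ RL_integral a (2 - alpha) y t @[t --> a^'+] --> Ia,
          RL_derivative a (alpha - 1) y t @[t --> a^'+] --> Da
        & Ia - Da = 0];
    sol_boundary_b : exists2 Db : R,
      RL_derivative a (alpha - 1) y t @[t --> b^'-] --> Db & y b + Db = 0
  }.

(* Main.v *)
(** Put beta = alpha - 1, f = p y and u = I^(2 - alpha) y. Integrating u'' = - f twice from a, with
    the common limit c of u and u' at a, gives u = c + I^1 (c - I^1 f); applying I^beta and the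
    semigroup law of fractional integrals, then differentiating, yields
      y(t) = c (t - a)^(beta - 1) / Gamma(beta) + c (t - a)^beta / Gamma(alpha) - I^alpha f (t).
    Write A(t) for the coefficient of c. The condition at b determines c, and y becomes the
    integral of f against a Green kernel which, multiplied by A(b) + 1, lies between 0 and
    A(t) Q(s), where Q(s) = (b - s)^beta / Gamma(alpha) + 1. Hence
      |y(t)| <= A(t) T / (A(b) + 1), where T is the integral of Q |p y|.
    Multiplying by Q |p| and integrating, T > 0 cancels; since Q < Q(a) on ]a, b[ and p does not
    vanish almost everywhere, the remaining inequality is strict. *)

Require Import Defs.
From HB Require Import structures.
From mathcomp Require Import all_boot all_order all_algebra.
From mathcomp Require Import all_classical all_reals all_analysis.
From mathcomp Require Import measurable_realfun ring.

Import Order.TTheory GRing.Theory Num.Theory.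
Import numFieldNormedType.Exports.

Local Open Scope classical_set_scope.
Local Open Scope ring_scope.

(** * Affine change of variables *)

(** When alpha < 2 a solution may blow up at a like (t - a)^(beta - 1), so its maximum cannot serve
    as a norm. The coefficient A(t) has the same singularity and takes over that role. Since A(s) =
    (s - a)^(beta - 1) (beta + s - a) / Gamma(alpha), bounding s - a by b - a in the second factor
    produces both the weight (s - a)^(alpha - 2) and the factor b - a + alpha - 1 of the theorem;
    A(b) + 1 and Q(a) supply the remaining factors. The equation speaks of u, and y has to be
    recovered from it. Applying I^beta brings the total order to (alpha - 1) + (2 - alpha) = 1, so
    that one classical derivative at a continuity point returns y. This requires the semigroup law
    at every t and not only almost everywhere; Fubini gives it when the total order is at least 1,
    because the composite kernel is then bounded. Real integrals take the value 0 when they diverge,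
    so integrability is carried along with each identity, and the Gamma integral is studied in the
    extended reals before it is known to be finite. *)

Definition affine (R : realType) (k c : R)
  : measurableTypeR R -> measurableTypeR R := fun x => k * x + c.

Lemma measurable_affine (R : realType) (k c : R) :
  measurable_fun [set: measurableTypeR R] (affine R k c).
Proof. by apply: measurable_funD => //; apply: measurable_funM. Qed.

(** Lebesgue measure is determined by its values on the intervals []x, y]], and the preimage of such
    an interval is an interval whose length is divided by [k]. *)
Lemma lebesgue_measure_affine (R : realType) (k c : R) (k0 : 0 < k) (A : set R) :
  measurable A ->
  pushforward (mscale (NngNum (ltW k0)) lebesgue_measure) (affine R k c) A =
  lebesgue_measure A.
Proof.
move=> mA; apply/esym/lebesgue_measure_unique => //.
  exact: measurable_affine.
move=> mf _ [[x y] _ <-].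
rewrite [RHS](_ : _ =
  (k%:E * lebesgue_measure (affine R k c @^-1` `]x, y]))%E)//.
rewrite (_ : _ @^-1` _ = `](x - c) / k, (y - c) / k]%classic); last first.
  apply/seteqP; split => z /=; rewrite /affine !in_itv/= ltr_pdivrMr//
    ler_pdivlMr// ltrBlDr lerBrDr (mulrC z)//.
rewrite !lebesgue_measure_itv/= !lte_fin ltr_pM2r ?invr_gt0// ltrD2r.
case: ifPn => _; last by rewrite mule0.
rewrite -!EFinB -EFinM; congr (_%:E); field; exact: lt0r_neq0.
Qed.

Lemma ge0_integral_affine (R : realType) (k c : R) (f : R -> \bar R) :
  0 < k -> measurable_fun setT f -> (forall x, 0 <= f x)%E ->
  (\int[lebesgue_measure]_x f x =
   k%:E * \int[lebesgue_measure]_x f (k * x + c)%R)%E.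
Proof.
move=> k0 mf f0.
have mphi := measurable_affine R k c.
have mfphi : measurable_fun setT (f \o affine R k c).
  exact: (measurableT_comp mf mphi).
have := @ge0_integral_mscale _ _ _ lebesgue_measure _ measurableT (NngNum (ltW k0))
  (f \o affine R k c) mfphi (fun x _ => f0 _).
move=> /= <-.
rewrite -(preimage_setT (affine R k c)) -(ge0_integral_pushforward mphi)//.
by apply: eq_measure_integral => A mA _; exact/esym/lebesgue_measure_affine.
Qed.

(** A nonnegative function with zero integral vanishes almost everywhere, which would put [D] inside
    a null set. *)
Lemma integral_gt0 (R : realType) (D : set R) (f : R -> \bar R) :
  measurable D -> (0 < lebesgue_measure D)%E -> measurable_fun D f ->
  (forall x, D x -> 0 < f x)%E -> (0 < \int[lebesgue_measure]_(x in D) f x)%E.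
Proof.
move=> mD D0 mf f0.
rewrite lt_neqAle integral_ge0 ?andbT; last by move=> x /f0 /ltW.
apply/negP => /eqP/esym i0.
have /(ae_eq_integral_abs lebesgue_measure mD mf) :
    (\int[lebesgue_measure]_(x in D) `|f x| = 0)%E.
  by rewrite -i0; apply: eq_integral => x /set_mem Dx; rewrite gee0_abs// ltW// f0.
move=> [N [mN N0]] DN.
have : (lebesgue_measure D <= lebesgue_measure N)%E.
  apply: le_measure; rewrite ?inE// => x Dx; apply: DN => /= /(_ Dx).
  by move=> fx0; have := f0 _ Dx; rewrite fx0 ltxx.
by rewrite N0 leNgt D0.
Qed.

(** * The Gamma and Beta integrals *)

Section beta_gamma.
Context {R : realType}.
Implicit Types x y v : R.
Notation mu := (@lebesgue_measure R).

(* Extended by 0 to v <= 0, so that fractional integrals are convolutions on the whole line. *)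
Definition pker x v : R := if 0 < v then v `^ (x - 1) else 0.

Lemma pker_ge0 x v : 0 <= pker x v.
Proof. by rewrite /pker; case: ifP => // _; exact: powR_ge0. Qed.

Lemma pker_gt0 x v : 0 < v -> 0 < pker x v.
Proof. by rewrite /pker => v0; rewrite v0 powR_gt0. Qed.

Lemma le0_pker x v : v <= 0 -> pker x v = 0.
Proof. by rewrite /pker ltNge => ->. Qed.

Lemma pkerE x v : 0 < v -> pker x v = v `^ (x - 1).
Proof. by rewrite /pker => ->. Qed.

Lemma measurable_pker x : measurable_fun setT (pker x).
Proof.
apply: measurable_fun_ifT => //; first exact: measurable_fun_ltr.
Qed.

Lemma measurable_pker_comp d (T : measurableType d) x (f : T -> R) :
  measurable_fun setT f -> measurable_fun setT (fun t => pker x (f t)).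
Proof. by move=> mf; apply: measurableT_comp => //; exact: measurable_pker. Qed.

(** Extended-real values let Tonelli's theorem act before finiteness is known; finiteness is then
    deduced from the resulting identities. *)
Definition eGamma x : \bar R := (\int[mu]_v (pker x v * expR (- v))%:E)%E.

Definition eBeta x y : \bar R := (\int[mu]_s (pker x s * pker y (1 - s))%:E)%E.

Lemma Gamma_fine x : Gamma x = fine (eGamma x).
Proof.
rewrite /Gamma /Rintegral integral_mkcond; congr fine; apply: eq_integral => v _.
rewrite patchE /pker mem_setE in_itv/= andbT.
by case: ifPn => //; rewrite mul0r.
Qed.

Lemma pkerM x k v : 0 < k -> pker x (k * v) = k `^ (x - 1) * pker x v.
Proof.
move=> k0; rewrite /pker pmulr_rgt0//; case: ifPn => v0; last by rewrite mulr0.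
by rewrite powRM// ltW.
Qed.

Lemma measurable_pker_conv x y v :
  measurable_fun setT (fun s => (pker x s * pker y (v - s))%:E).
Proof.
apply/measurable_EFinP; apply: measurable_funM; first exact: measurable_pker.
by apply: measurable_pker_comp; apply: measurable_funB.
Qed.

(** For v > 0, a dilation by v extracts v^(x - 1) and v^(y - 1) from the kernels and v from the
    measure, leaving the Beta integral. For v <= 0 one of the two kernels always vanishes. *)
Lemma pker_conv x y v :
  (\int[mu]_s (pker x s * pker y (v - s))%:E = (pker (x + y) v)%:E * eBeta x y)%E.
Proof.
have [v0|v0] := ltP 0 v; last first.
  rewrite le0_pker// mul0e integral0_eq// => s _.
  have [s0|s0] := ltP 0 s; last by rewrite le0_pker// mul0r.
  by rewrite (le0_pker y) ?mulr0// subr_le0 (le_trans v0)// ltW.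
have := @ge0_integral_affine R v 0 _ v0 (measurable_pker_conv x y v).
move=> -> => [|s]; last by rewrite lee_fin mulr_ge0 ?pker_ge0.
under eq_integral => s _.
  rewrite addr0 -[X in X - _]mulr1 -mulrBr !pkerM// mulrACA EFinM.
  over.
rewrite ge0_integralZl_EFin//; last 3 first.
- by move=> s _; rewrite lee_fin mulr_ge0 ?pker_ge0.
- exact: measurable_pker_conv.
- by rewrite mulr_ge0 ?powR_ge0.
rewrite muleA -EFinM pkerE//; congr (_%:E * _)%E.
rewrite -powRD ?(gt_eqF v0) ?implybT// -{1}(powRr1 (ltW v0)) -powRD ?(gt_eqF v0) ?implybT//.
by congr (_ `^ _); ring.
Qed.

Lemma eGamma_ge0 x : (0 <= eGamma x)%E.
Proof. by apply: integral_ge0 => v _; rewrite lee_fin mulr_ge0 ?pker_ge0 ?expR_ge0. Qed.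

Lemma eBeta_ge0 x y : (0 <= eBeta x y)%E.
Proof. by apply: integral_ge0 => v _; rewrite lee_fin mulr_ge0 ?pker_ge0. Qed.

Lemma measurable_Gamma_integrand x : measurable_fun setT (fun v => (pker x v * expR (- v))%:E).
Proof.
apply/measurable_EFinP; apply: measurable_funM; first exact: measurable_pker.
by apply: measurableT_comp.
Qed.

(** The function [F] below is integrated over the plane in both orders: over v first, a translation
    by s gives the product of the Gamma integrals; over s first, [pker_conv] applies. As an identity
    in the extended reals it can itself be used to prove finiteness. *)
Lemma eGammaM x y : (eGamma x * eGamma y = eBeta x y * eGamma (x + y))%E.
Proof.
pose F (z : measurableTypeR R * measurableTypeR R) : \bar R := (pker x z.1 * pker y (z.2 - z.1) * expR (- z.2))%:E.
have mF : measurable_fun setT F.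
  apply/measurable_EFinP; apply: measurable_funM; last first.
    by apply: measurableT_comp => //; apply: measurableT_comp.
  apply: measurable_funM; first exact: measurable_pker_comp.
  by apply: measurable_pker_comp; exact: measurable_funB.
have F0 z : (0 <= F z)%E.
  by rewrite lee_fin !mulr_ge0 ?pker_ge0 ?expR_ge0.
transitivity (\int[mu]_s \int[mu]_v F (s, v))%E.
  rewrite /eGamma -ge0_integralZr//; last 3 first.
  - exact: measurable_Gamma_integrand.
  - by move=> v _; rewrite lee_fin mulr_ge0 ?pker_ge0 ?expR_ge0.
  - exact: eGamma_ge0.
  apply: eq_integral => s _.
  rewrite -/(eGamma y) /eGamma (@ge0_integral_affine _ 1 (- s))//=; last 2 first.
  - exact: measurable_Gamma_integrand.
  - by move=> v; rewrite lee_fin mulr_ge0 ?pker_ge0 ?expR_ge0.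
  rewrite mul1e -ge0_integralZl_EFin//; last 3 first.
  - by move=> v _; rewrite lee_fin mulr_ge0 ?pker_ge0 ?expR_ge0.
  - apply/measurable_EFinP; apply: measurable_funM.
      by apply: measurable_pker_comp; apply: measurable_funD => //; exact: measurable_funM.
    apply: measurableT_comp => //; apply: measurableT_comp => //.
    by apply: measurable_funD => //; exact: measurable_funM.
  - by rewrite mulr_ge0 ?pker_ge0 ?expR_ge0.
  apply: eq_integral => v _; rewrite /F -EFinM/= mul1r; congr EFin.
  rewrite mulrACA -expRD; congr (_ * expR _); ring.
rewrite [LHS](fubini_tonelli F)//=.
rewrite /eGamma -ge0_integralZl//; last 3 first.
- exact: measurable_Gamma_integrand.
- by move=> v _; rewrite lee_fin mulr_ge0 ?pker_ge0 ?expR_ge0.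
- exact: eBeta_ge0.
apply: eq_integral => v _.
rewrite EFinM muleA (muleC (eBeta _ _)) -pker_conv -ge0_integralZr//; last 2 first.
- exact: measurable_pker_conv.
- by move=> s _; rewrite lee_fin mulr_ge0 ?pker_ge0.
Qed.

End beta_gamma.

(** * Positivity and finiteness of the Gamma and Beta integrals *)

Section gamma_finite.
Context {R : realType}.
Implicit Types x y v : R.
Notation mu := (@lebesgue_measure R).

Lemma integralT_gt0 (f : R -> \bar R) (a b : R) : a < b ->
  measurable_fun setT f -> (forall x, 0 <= f x)%E ->
  (forall x, (a < x < b)%R -> 0 < f x)%E -> (0 < \int[mu]_x f x)%E.
Proof.
move=> ab mf f0 fp.
apply: (@lt_le_trans _ _ (\int[mu]_(x in `]a, b[) f x)%E); last first.
  exact: ge0_subset_integral.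
apply: integral_gt0 => //.
- by rewrite lebesgue_measure_itv/= lte_fin ab -EFinB lte_fin subr_gt0.
- exact: measurable_funTS.
Qed.

Lemma eGamma_gt0 x : (0 < eGamma x)%E.
Proof.
apply: (@integralT_gt0 _ 0 1) => //; first exact: measurable_Gamma_integrand.
- by move=> v; rewrite lee_fin mulr_ge0 ?pker_ge0 ?expR_ge0.
- by move=> v /andP[v0 _]; rewrite lte_fin mulr_gt0 ?pker_gt0 ?expR_gt0.
Qed.

Lemma eBeta_gt0 x y : (0 < eBeta x y)%E.
Proof.
apply: (@integralT_gt0 _ 0 1) => //; first exact: measurable_pker_conv.
- by move=> v; rewrite lee_fin mulr_ge0 ?pker_ge0.
- by move=> v /andP[v0 v1]; rewrite lte_fin mulr_gt0 ?pker_gt0 ?subr_gt0.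
Qed.

Lemma eq_integral_except1 (f g : R -> \bar R) (c : R) :
  measurable_fun setT f -> measurable_fun setT g ->
  (forall x, x != c -> f x = g x) ->
  (\int[mu]_x f x = \int[mu]_x g x)%E.
Proof.
move=> mf mg fg.
have mc : measurable ([set: R] `\ c) by exact: measurableD.
rewrite -(@integral_setD1 R f c setT)//; last exact: measurable_funTS.
rewrite -(@integral_setD1 R g c setT)//; last exact: measurable_funTS.
by apply: eq_integral => x /set_mem[_ /= /eqP]; exact: fg.
Qed.

(** The integrand is the density of the exponential law of rate 1, except at 0, where the density is
    1 and [pker] is 0. *)
Lemma eGamma1 : eGamma (1 : R) = 1%E.
Proof.
rewrite -(@integral_exponential_pdf R 1)//.
apply: (@eq_integral_except1 _ _ 0).
- exact: measurable_Gamma_integrand.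
- by apply/measurable_EFinP; exact: measurable_exponential_pdf.
- move=> v v0; rewrite /pker subrr powRr0 /exponential_pdf patchE mem_setE in_itv/= andbT.
  rewrite le_eqVlt eq_sym (negbTE v0)/=.
  by case: ifP => _; rewrite ?mul0r// mulN1r mul1r.
Qed.

(** The bound is independent of [e], so it survives the limit e -> 0, where the integrand is
    singular if x < 1. *)
Lemma power_integral_le x e : 0 < x -> 0 < e -> e < 1 ->
  (\int[mu]_(s in `[e, 1%R]) (s `^ (x - 1))%:E <= x^-1%:E)%E.
Proof.
move=> x0 e0 e1.
have drv (s : R) : 0 < s -> is_derive s 1 (fun s : R => x^-1 * s `^ x) (s `^ (x - 1)).
  move=> s0; have := is_derive1_powR x s0.
  move=> /(@is_deriveZ _ _ _ _ x^-1) H; apply: is_derive_eq.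
  by rewrite /GRing.scale/= mulrA mulVf ?mul1r// gt_eqF.
have cF (s : R) : 0 < s -> {for s, continuous (fun s : R => x^-1 * s `^ x)}.
  move=> s0; apply: differentiable_continuous; apply/derivable1_diffP.
  by have [] := drv _ s0.
rewrite (@continuous_FTC2 R _ (fun s : R => x^-1 * s `^ x))//.
- rewrite powR1 mulr1 -EFinB lee_fin gerBl mulr_ge0 ?powR_ge0//.
  by rewrite invr_ge0 ltW.
- apply: continuous_in_subspaceT => s; rewrite inE/= in_itv/= => /andP[es _].
  apply: differentiable_continuous; apply/derivable1_diffP.
  by apply: derivable_powR; rewrite in_itv/= andbT (lt_le_trans e0).
- split.
  + move=> s; rewrite in_itv/= => /andP[es _].
    by have [] := drv s (lt_trans e0 es).
  + by apply: cvg_at_right_filter; exact: cF.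
  + by apply: cvg_at_left_filter; apply: cF.
- move=> s; rewrite in_itv/= => /andP[es _].
  by rewrite derive1E; have [_] := drv s (lt_trans e0 es).
Qed.

(* The singularity at 0 is exhausted by the intervals [1 / (n + 2), 1]. *)
Lemma eBeta1_lty x : 0 < x -> (eBeta x 1 < +oo)%E.
Proof.
move=> x0; apply: (@le_lt_trans _ _ x^-1%:E); last by rewrite ltry.
(* The shift by 2 keeps the left endpoint strictly below 1, as [power_integral_le] requires. *)
pose F (n : nat) : set R := `[n.+2%:R^-1, 1]%classic.
have F0 n s : F n s -> 0 < s.
  by rewrite /F /= in_itv/= => /andP[+ _]; apply: lt_le_trans; rewrite invr_gt0.
have ->: eBeta x 1 = (\int[mu]_(s in \bigcup_n F n) (pker x s)%:E)%E.
  have -> : \bigcup_n F n = `]0, 1]%classic.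
    apply/seteqP; split => s.
      move=> [n _] Fs; rewrite /= in_itv/= (F0 _ _ Fs)/=.
      by move: Fs; rewrite /F/= in_itv/= => /andP[].
    rewrite /= in_itv/= => /andP[s0 s1].
    exists (Num.truncn s^-1) => //; rewrite /F/= in_itv/= s1 andbT.
    rewrite -[leRHS]invrK lef_pV2 ?posrE ?invr_gt0//.
    apply/ltW/(lt_trans (truncnS_gt _)); rewrite ltr_nat//.
  rewrite [RHS]integral_mkcond/=.
  rewrite /eBeta; apply: (@eq_integral_except1 _ _ 1).
  - exact: measurable_pker_conv.
  - apply/(measurable_restrictT (fun s => (pker x s)%:E)) => //.
    apply: (@measurable_funTS _ _ _ _ _ (fun s => (pker x s)%:E)).
    by apply/measurable_EFinP; exact: measurable_pker.
  - move=> s s1; rewrite patchE mem_setE in_itv/= {2}/pker subrr powRr0 subr_gt0.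
    rewrite (le_eqVlt s) (negbTE s1)/=; have [s0|s0] := ltP 0 s; case: ifPn => //= _.
    + by rewrite mulr1.
    + by rewrite mulr0.
    + by rewrite mulr1 le0_pker.
    + by rewrite mulr0.
have mF i : measurable (F i) by exact: measurable_itv.
have H : (\int[mu]_(s in F n) (pker x s)%:E @[n --> \oo] -->
    \int[mu]_(s in \bigcup_n F n) (pker x s)%:E)%E.
  apply: ge0_nondecreasing_set_cvg_integral => //.
  - apply/nondecreasing_seqP => n; rewrite subsetEset => s.
    rewrite /F/= !in_itv/= => /andP[h ->]; rewrite andbT (le_trans _ h)//.
    by rewrite lef_pV2 ?posrE// ler_nat.
  - by move=> i; apply: measurable_funTS; apply/measurable_EFinP; exact: measurable_pker.
  - by move=> i s _; rewrite lee_fin pker_ge0.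
rewrite -(cvg_lim _ H)//; apply: lime_le; first exact: cvgP H.
apply: nearW => n; rewrite (le_trans _ (@power_integral_le x n.+2%:R^-1 x0 _ _))//.
  + rewrite le_eqVlt; apply/orP; left; apply/eqP; apply: eq_integral => s /set_mem Fs.
    by rewrite pkerE// (F0 _ _ Fs).
  + by rewrite invf_lt1 ?ltr1n.
Qed.

(** On ]0, 1] the integrand is dominated by the sum of those of [eBeta y 1] (near 0) and [eGamma 1]
    (from 1 on). Larger arguments are reached by unit steps: by [eGammaM], [eGamma (y - 1)] is
    [eGamma y] times a positive factor, so it would be infinite if [eGamma y] were. *)
Lemma eGamma_lty x : 0 < x -> (eGamma x < +oo)%E.
Proof.
have le1 y : 0 < y -> y <= 1 -> (eGamma y < +oo)%E.
  move=> y0 y1.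
  apply: (@le_lt_trans _ _ (eBeta y 1 + eGamma 1)%E); last first.
    by rewrite eGamma1 lte_add_pinfty ?ltry// eBeta1_lty.
  rewrite /eGamma /eBeta -ge0_integralD//; last 4 first.
  - by move=> v _; rewrite lee_fin mulr_ge0 ?pker_ge0.
  - exact: measurable_pker_conv.
  - by move=> v _; rewrite lee_fin mulr_ge0 ?pker_ge0 ?expR_ge0.
  - exact: measurable_Gamma_integrand.
  apply: ge0_le_integral => //.
  - by move=> v _; rewrite lee_fin mulr_ge0 ?pker_ge0 ?expR_ge0.
  - exact: measurable_Gamma_integrand.
  - apply: emeasurable_funD; first exact: measurable_pker_conv.
    exact: measurable_Gamma_integrand.
  - move=> v _; rewrite -EFinD lee_fin.
    have [v0|v0] := ltP 0 v; last by rewrite !(le0_pker _ v)// !mul0r addr0.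
    have [v1|v1] := ltP v 1.
      rewrite ler_wpDr ?mulr_ge0 ?pker_ge0 ?expR_ge0//.
      rewrite ler_wpM2l ?pker_ge0// pkerE ?subr_gt0// subrr powRr0.
      by rewrite -expR0 ler_expR oppr_le0 ltW.
    rewrite ler_wpDl ?mulr_ge0 ?pker_ge0//.
    rewrite ler_wpM2r ?expR_ge0// !pkerE//.
    by rewrite ler_powR// lerB.
have step n y : 0 < y -> y <= n.+1%:R -> (eGamma y < +oo)%E.
  elim: n y => [|n IHn] y y0 yn; first exact: le1.
  have [y1|y1] := leP y 1; first exact: le1.
  have z0 : 0 < y - 1 by rewrite subr_gt0.
  have := eGammaM (y - 1) 1; rewrite eGamma1 mule1 subrK => E.
  have : (eGamma (y - 1) < +oo)%E by apply: IHn => //; rewrite lerBlDr natr1.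
  rewrite E; have := eBeta_gt0 (y - 1) 1; have := eGamma_gt0 y.
  case: (eGamma y) => [r|//|//]; first by rewrite ltry.
  case: (eBeta _ _) => [r _|_ _|//].
    by rewrite lte_fin => r0; rewrite gt0_muley.
  by rewrite gt0_muley.
move=> x0; apply: (step (Num.truncn x) _ x0).
exact/ltW/truncnS_gt.
Qed.

Lemma eGammaE x : 0 < x -> eGamma x = (Gamma x)%:E.
Proof.
move=> x0; rewrite Gamma_fine fineK// ge0_fin_numE ?eGamma_ge0//.
exact: eGamma_lty.
Qed.

Lemma Gamma_gt0 x : 0 < x -> 0 < Gamma x.
Proof. by move=> x0; rewrite -lte_fin -eGammaE// eGamma_gt0. Qed.

Lemma Gamma1 : Gamma (1 : R) = 1.
Proof. by rewrite Gamma_fine eGamma1. Qed.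

(** An infinite Beta integral is excluded by [eGammaM]: it would make the finite product of the two
    Gamma values infinite. *)
Lemma eBetaE x y : 0 < x -> 0 < y ->
  eBeta x y = (Gamma x * Gamma y / Gamma (x + y))%:E.
Proof.
move=> x0 y0; have := eGammaM x y; rewrite !eGammaE ?addr_gt0//.
have G0 := Gamma_gt0 _ (addr_gt0 x0 y0).
have := eBeta_gt0 x y; case: (eBeta x y) => //=.
  move=> r _; rewrite -!EFinM => -[->]; congr EFin; field; exact: lt0r_neq0.
by move=> _; rewrite gt0_mulye ?lte_fin// -EFinM.
Qed.

End gamma_finite.

(** * Fractional integrals *)

Section RL_semigroup.
Context {R : realType}.
Implicit Types (x y a t v : R) (f : R -> R).
Notation mu := (@lebesgue_measure R).

(** The normalisation makes these kernels a semigroup under convolution, with additive index x. *)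
Definition RLker x v : R := pker x v / Gamma x.

(* This is I^x from a when f vanishes on ]-oo, a]. *)
Definition RLint x f t : R := \int[mu]_s (RLker x (t - s) * f s).

Lemma RLker_ge0 x v : 0 < x -> 0 <= RLker x v.
Proof. by move=> x0; rewrite mulr_ge0 ?pker_ge0// invr_ge0 ltW// Gamma_gt0. Qed.

Lemma le0_RLker x v : v <= 0 -> RLker x v = 0.
Proof. by move=> v0; rewrite /RLker le0_pker// mul0r. Qed.

Lemma measurable_RLker_comp d (T : measurableType d) x (g : T -> R) :
  measurable_fun setT g -> measurable_fun setT (fun s => RLker x (g s)).
Proof. by move=> mg; apply: measurable_funM => //; exact: measurable_pker_comp. Qed.

Lemma measurable_RLkerB x t : measurable_fun setT (fun s : R => RLker x (t - s)).
Proof. by apply: measurable_RLker_comp; exact: measurable_funB. Qed.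

Lemma RLker_le x v L : 1 <= x -> 0 <= L -> v <= L ->
  RLker x v <= L `^ (x - 1) / Gamma x.
Proof.
move=> x1 L0 vL; have x0 : 0 < x by exact: lt_le_trans x1.
have G0 : 0 <= (Gamma x)^-1 by rewrite invr_ge0 ltW// Gamma_gt0.
rewrite ler_wpM2r// /pker; case: ifPn => v0; last exact: powR_ge0.
by rewrite ge0_ler_powR ?subr_ge0 ?nnegrE// ltW.
Qed.

(** A translation by r reduces this to [pker_conv], and the value of the Beta integral converts the
    two normalisations into the third. The integral is extended-real, so the identity also yields
    integrability of the product. *)
Lemma RLker_conv x y t r : 0 < x -> 0 < y ->
  (\int[mu]_s (RLker x (t - s) * RLker y (s - r))%:E = (RLker (x + y) (t - r))%:E)%E.
Proof.
move=> x0 y0.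
have := @ge0_integral_affine R 1 r (fun s : R => (RLker x (t - s) * RLker y (s - r))%:E) ltr01.
move=> -> ; last 2 first.
- apply/measurable_EFinP; apply: measurable_funM; first exact: measurable_RLkerB.
  by apply: measurable_RLker_comp; exact: measurable_funB.
- by move=> s; rewrite lee_fin mulr_ge0 ?RLker_ge0.
rewrite mul1e.
under eq_integral => s _.
  rewrite (_ : (_ * _)%R = ((Gamma x)^-1 * (Gamma y)^-1 *
     (pker y s * pker x ((t - r) - s)))%R); last first.
    rewrite /RLker mul1r addrK (_ : t - (s + r) = t - r - s); last by ring.
    by move: (pker x _) (pker y _) (Gamma x) (Gamma y) => p q A B; ring.
  rewrite EFinM.
  over.
rewrite ge0_integralZl_EFin//; last 3 first.
- by move=> s _; rewrite lee_fin mulr_ge0 ?pker_ge0.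
- exact: measurable_pker_conv.
- by rewrite mulr_ge0// invr_ge0 ltW// Gamma_gt0.
rewrite pker_conv eBetaE// -!EFinM /RLker (addrC y x); congr EFin.
have := Gamma_gt0 _ x0; have := Gamma_gt0 _ y0; have := Gamma_gt0 _ (addr_gt0 x0 y0).
move: (Gamma x) (Gamma y) (Gamma (x + y)) (pker _ _) => A B C p C0 B0 A0.
by field; rewrite !gt_eqF.
Qed.

(** For k > 0, if [f] is not integrable then neither is [k * f], and both real integrals take the
    default value 0. This covers the points where a fractional integral diverges. *)
Lemma Rintegral_pZl (D : set R) k f : measurable D -> measurable_fun D f -> 0 <= k ->
  \int[mu]_(s in D) (k * f s) = k * \int[mu]_(s in D) f s.
Proof.
move=> mD mf; rewrite le_eqVlt => /predU1P[<-|k0].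
  by rewrite mul0r; under eq_Rintegral do rewrite mul0r; rewrite Rintegral_cst// mul0r.
have [/integrableP fi|fi] := pselect (mu.-integrable D (EFin \o f)).
  by rewrite RintegralZl//; apply/integrableP.
have H (g : R -> R) : measurable_fun D g -> ~ mu.-integrable D (EFin \o g) ->
    \int[mu]_(s in D) g s = 0.
  move=> mg gi; rewrite /Rintegral.
  have : (\int[mu]_(s in D) (g s)%:E)%E \isn't a fin_num.
    apply/negP; rewrite -integral_fin_num_abs// => h.
    by apply: gi; apply/integrableP; split => //; exact/measurable_EFinP.
  by case: (\int[mu]_(s in D) (g s)%:E)%E.
rewrite !H ?mulr0//; first exact: measurable_funM.
move=> kfi; apply: fi.
have := @integrableZl _ _ _ mu _ mD k^-1 _ kfi.
apply: eq_integrable => // s _ /=.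
by rewrite -EFinM mulrA mulVf ?mul1r// gt_eqF.
Qed.

Definition RL_integrable x t f :=
  mu.-integrable setT (fun s : R => (RLker x (t - s) * f s)%:E).

(** For x >= 1 the kernel has no singularity and is bounded on the support of the integrand. *)
Lemma RL_integrable_bounded x a t f : 1 <= x ->
  measurable_fun setT f -> (forall r, r <= a -> f r = 0) ->
  mu.-integrable `]a, t[ (EFin \o f) -> RL_integrable x t f.
Proof.
move=> x1 mf f0 fi; have x0 : 0 < x by exact: lt_le_trans x1.
have mkf : measurable_fun setT (fun r : R => (RLker x (t - r) * f r)).
  by apply: measurable_funM => //; exact: measurable_RLkerB.
(* The absolute value also covers t <= a, where []a, t[] is empty. *)
pose M := `|t - a| `^ (x - 1) / Gamma x.
have M0 : 0 <= M by rewrite mulr_ge0 ?powR_ge0// invr_ge0 ltW// Gamma_gt0.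
apply: (@le_integrable _ _ _ mu _ measurableT _
  (fun r => M%:E * ((EFin \o f) \_ `]a, t[) r)%E).
- exact/measurable_EFinP.
- move=> r _; rewrite patchE mem_setE in_itv/=.
  have [ra|ar] := leP r a; first by rewrite f0// mulr0 [leLHS]abse0 abse_ge0.
  have [rt|tr] := ltP r t; last first.
    by rewrite le0_RLker ?subr_le0// mul0r [leLHS]abse0 abse_ge0.
  rewrite /= lee_fin normrM [leRHS]normrM ler_wpM2r// (ger0_norm M0).
  rewrite ger0_norm ?RLker_ge0//.
  by apply: RLker_le => //; rewrite (le_trans _ (ler_norm _))// lerB// ltW.
- by apply: integrableZl => //; apply/integrable_restrict => //; rewrite setTI.
Qed.

(** Fubini for [F] on the plane. Integrating |F| over s first gives the kernel of order x + y
    against |f|, which is integrable because that order is at least 1; x and y themselves may be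
    below 1, with singular kernels. The first conjunct records that the iterated integral is a
    convergent one. *)
Lemma RLint_semigroup x y a t f : 0 < x -> 0 < y -> 1 <= x + y ->
  measurable_fun setT f -> (forall r, r <= a -> f r = 0) ->
  mu.-integrable `]a, t[ (EFin \o f) ->
  RL_integrable x t (RLint y f) /\
  RLint x (RLint y f) t = RLint (x + y) f t.
Proof.
move=> x0 y0 xy mf f0 fi.
pose F (z : measurableTypeR R * measurableTypeR R) : \bar R :=
  (RLker x (t - z.1) * (RLker y (z.1 - z.2) * f z.2))%:E.
have mF : measurable_fun setT F.
  apply/measurable_EFinP; apply: measurable_funM.
    by apply: measurable_RLker_comp; exact: measurable_funB.
  apply: measurable_funM; last exact: measurableT_comp.
  by apply: measurable_RLker_comp; exact: measurable_funB.
have Kint r : mu.-integrable setT (fun s : R => (RLker x (t - s) * RLker y (s - r))%:E).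
  apply/integrableP; split.
    apply/measurable_EFinP; apply: measurable_funM; first exact: measurable_RLkerB.
    by apply: measurable_RLker_comp; exact: measurable_funB.
  rewrite [X in (X < _)%E](_ : _ = (RLker (x + y) (t - r))%:E) ?ltry//.
  rewrite -RLker_conv//; apply: eq_integral => s _.
  by rewrite gee0_abs// lee_fin mulr_ge0// RLker_ge0.
have FG r : (\int[mu]_s F (s, r) = (RLker (x + y) (t - r) * f r)%:E)%E.
  rewrite EFinM -(RLker_conv x y) // -integralZr//.
  by apply: eq_integral => s _; rewrite /F/= -EFinM mulrA.
have FGabs r : (\int[mu]_s `|F (s, r)| = (RLker (x + y) (t - r) * `|f r|)%:E)%E.
  rewrite EFinM -(RLker_conv x y) // -integralZr//.
  apply: eq_integral => s _.
  rewrite [LHS](_ : _ = `|RLker x (t - s) * (RLker y (s - r) * f r)|%:E)//.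
  by rewrite -EFinM mulrA [in LHS]normrM (ger0_norm (mulr_ge0 (RLker_ge0 _ _ x0) (RLker_ge0 _ _ y0))).
have kfi := RL_integrable_bounded _ _ _ _ xy mf f0 fi.
have Fi : (mu \x mu)%E.-integrable setT F.
  apply/integrable21ltyP => //.
  under eq_integral do rewrite FGabs.
  have /integrableP[mkf] := kfi; apply: le_lt_trans.
  apply: ge0_le_integral => //.
  - by move=> r _; rewrite lee_fin mulr_ge0// RLker_ge0// addr_gt0.
  - apply/measurable_EFinP; apply: measurable_funM; first exact: measurable_RLkerB.
    exact: measurableT_comp.
  - by apply: measurableT_comp => //; exact: mkf.
  - by move=> r _; rewrite /= lee_fin normrM (ger0_norm (RLker_ge0 _ _ (addr_gt0 x0 y0))).
pose S s := (\int[mu]_r F (s, r))%E.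
have Si : mu.-integrable setT S := integrable_fubini_F Fi.
have mS : measurable_fun setT S := measurable_int _ Si.
(* At an individual s the section may fail to be integrable, so the factor is pulled out by
   [Rintegral_pZl], which respects the default value. *)
have SE s : (fine (S s)) = RLker x (t - s) * RLint y f s.
  have mg : measurable_fun setT (fun r : R => RLker y (s - r) * f r).
    by apply: measurable_funM => //; exact: measurable_RLkerB.
  have := Rintegral_pZl setT _ _ measurableT mg (RLker_ge0 x (t - s) x0).
  by apply.
have mfS : measurable_fun setT (fun s => (fine (S s))%:E).
  by apply/measurable_EFinP; exact: measurableT_comp.
have fSi : mu.-integrable setT (fun s => (fine (S s))%:E).
  apply: le_integrable Si => // s _.
  by case: (S s) => //= ; rewrite normr0 leey.
split.
  by apply: eq_integrable fSi => // s _; rewrite SE.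
rewrite /RLint /Rintegral; congr fine.
transitivity (\int[mu]_s (fine (S s))%:E)%E.
  by apply: eq_integral => s _; rewrite SE.
(* Fubini makes [S] finite almost everywhere only, so [fine] is removed under the integral and not
   pointwise. *)
transitivity (\int[mu]_s S s)%E.
  apply: ae_eq_integral => //.
  have := integrable_ae measurableT Si; apply: filterS => s h _.
  by rewrite fineK// h.
rewrite /S (Fubini Fi).
by apply: eq_integral => r _; rewrite FG.
Qed.

End RL_semigroup.

(** * Primitives on an open interval *)

Section primitives.
Context {R : realType}.
Implicit Types (a b s t c l : R) (f h k : R -> R).
Notation mu := (@lebesgue_measure R).

Lemma is_derive_integral_itv a b t f : a < t < b ->
  mu.-integrable `]a, b[ (EFin \o f) -> {for t, continuous f} ->
  is_derive t 1 (fun s => \int[mu]_(r in `]a, s]) f r) (f t).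
Proof.
move=> /andP[aT tb] fi cf.
(* The fundamental theorem of calculus is applied on an interval reaching strictly beyond t; the
   midpoint of t and b keeps it inside ]a, b[. *)
have um : t < (t + b) / 2 by rewrite midf_lt.
have ui : mu.-integrable `]a, (t + b) / 2] (EFin \o f).
  apply: integrableS fi => //; apply: subset_itvl; rewrite bnd_simp.
  by rewrite midf_lt.
have at' : (BRight a < BRight t)%O by rewrite bnd_simp.
have [] := continuous_FTC1 um ui at' cf.
by move=> d <-; rewrite derive1E; exact/derivableP.
Qed.

Lemma eq_derive0_itv a b h : (forall t, a < t < b -> is_derive t 1 h 0) ->
  forall s t, a < s -> s <= t -> t < b -> h s = h t.
Proof.
move=> h0 s t sa st tb.
have dh r : r \in `[s, t] -> is_derive r 1 h 0.
  rewrite in_itv/= => /andP[sr rt].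
  by apply: h0; rewrite (lt_le_trans sa)//= (le_lt_trans rt).
have dh' r : r \in `]s, t[ -> is_derive r 1 h (cst 0 r).
  by move=> rst; apply: dh; exact: subset_itv_oo_cc.
have ch : {within `[s, t], continuous h}.
  by apply: derivable_within_continuous => r /dh [].
have [c _] := MVT_segment st dh' ch.
by rewrite mul0r => /eqP; rewrite subr_eq0 => /eqP.
Qed.

Lemma integral_itv_cvg_left a b f : a < b ->
  mu.-integrable `]a, b[ (EFin \o f) ->
  \int[mu]_(r in `]a, t]) f r @[t --> a^'+] --> 0.
Proof.
move=> ab fi.
have fi' : mu.-integrable `[a, b] (EFin \o (f \_ `]a, b[)).
  rewrite -restrict_EFin; apply/integrable_restrict => //=.
  by rewrite setIidr//; exact: subset_itv_oo_cc.
have := parameterized_integral_cvg_left ab fi'.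
move=> /cvg_at_right_filter; apply: cvg_trans; apply: near_eq_cvg.
near=> t; rewrite /parameterized_integral.
have tb : t < b by near: t; exact: nbhs_right_lt.
rewrite -Rintegral_itv_obnd_cbnd; last first.
  by apply: integrableS fi' => //; apply: subset_itv; rewrite bnd_simp// ltW.
apply: eq_Rintegral => r; rewrite inE/= in_itv/= => /andP[ar rt].
by rewrite patchE mem_setE in_itv/= ar (le_lt_trans rt).
Unshelve. all: by end_near. Qed.

Lemma integral_itv_cvg_right a b f : a < b ->
  mu.-integrable `]a, b[ (EFin \o f) ->
  \int[mu]_(r in `]a, t]) f r @[t --> b^'-] --> \int[mu]_(r in `]a, b[) f r.
Proof.
move=> ab fi.
have fi' : mu.-integrable `[a, b] (EFin \o (f \_ `]a, b[)).
  rewrite -restrict_EFin; apply/integrable_restrict => //=.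
  by rewrite setIidr//; exact: subset_itv_oo_cc.
have := parameterized_integral_cvg_at_left ab fi'.
have -> : parameterized_integral mu a b (f \_ `]a, b[) = \int[mu]_(r in `]a, b[) f r.
  rewrite /parameterized_integral -Rintegral_mkcondr.
  by rewrite setIidr//; exact: subset_itv_oo_cc.
apply: cvg_trans; apply: near_eq_cvg.
near=> t; rewrite /parameterized_integral.
have tb : t < b by near: t; exact: nbhs_left_lt.
rewrite -Rintegral_itv_obnd_cbnd; last first.
  by apply: integrableS fi' => //; apply: subset_itv; rewrite bnd_simp// ltW.
apply: eq_Rintegral => r; rewrite inE/= in_itv/= => /andP[ar rt].
by rewrite patchE mem_setE in_itv/= ar (le_lt_trans rt).
Unshelve. all: by end_near. Qed.

(** Only a one-sided limit of [h] is known at a. The difference of [h] and the integral of [k] has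
    zero derivative, hence is constant on ]a, b[, and the limit at a identifies the constant. *)
Lemma primitive_from_left a b l h k : a < b ->
  (forall t, a < t < b -> is_derive t 1 h (k t)) ->
  (forall t, a < t < b -> {for t, continuous k}) ->
  mu.-integrable `]a, b[ (EFin \o k) ->
  h t @[t --> a^'+] --> l ->
  forall t, a < t < b -> h t = l + \int[mu]_(s in `]a, t]) k s.
Proof.
move=> ab dh ck ki hl t /andP[aT tb].
pose D t := h t - \int[mu]_(s in `]a, t]) k s.
have dD s : a < s < b -> is_derive s 1 D 0.
  move=> sab; rewrite -(subrr (k s)).
  apply: (@is_deriveB _ _ _ h (fun t => \int[mu]_(s in `]a, t]) k s)).
    exact: dh.
  by apply: (@is_derive_integral_itv a b) => //; exact: ck.
have Dl : D s @[s --> a^'+] --> l.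
  rewrite -[l]subr0; apply: cvgB => //; exact: (integral_itv_cvg_left _ _ _ ab ki).
have Dt : D s @[s --> a^'+] --> D t.
  apply: (@cvg_trans _ (D t @[s --> a^'+])); last exact: cvg_cst.
  apply: near_eq_cvg; near=> s.
  apply/esym; apply: (eq_derive0_itv _ _ _ dD) => //.
  by near: s; exact: nbhs_right_le.
by have -> : l = D t; [exact: cvg_unique Dl Dt|rewrite subrK].
Unshelve. all: by end_near. Qed.

End primitives.

(** * Order one, recursion of Gamma, and continuity of fractional integrals *)

Section RLint_facts.
Context {R : realType}.
Implicit Types (x a b t v : R) (f y : R -> R).
Notation mu := (@lebesgue_measure R).

Lemma RLker1 v : RLker 1 v = if 0 < v then 1 else 0.
Proof. by rewrite /RLker /pker Gamma1 divr1 subrr powRr0. Qed.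

Lemma RLint1E a t f : measurable_fun setT f -> (forall r, r <= a -> f r = 0) ->
  RLint 1 f t = \int[mu]_(s in `]a, t]) f s.
Proof.
move=> mf f0; rewrite [RHS]/Rintegral -integral_itv_bndo_bndc; last first.
  by apply/measurable_EFinP; exact: measurable_funTS.
rewrite -/(Rintegral mu _ _) Rintegral_mkcond; apply: eq_Rintegral => s _.
rewrite patchE mem_setE in_itv/= RLker1 subr_gt0.
have [sa|as_] := leP s a; first by rewrite f0// mulr0.
by case: (s < t); [rewrite mul1r|rewrite mul0r].
Qed.

Lemma RL_integralE a b t x y : 0 < x -> t <= b ->
  measurable_fun setT (y \_ `]a, b[) ->
  RL_integral a x y t = RLint x (y \_ `]a, b[) t.
Proof.
move=> x0 tb my; rewrite /RL_integral gt_eqF// /RLint Rintegral_mkcond.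
rewrite -Rintegral_pZl//; last first.
- by rewrite invr_ge0 ltW// Gamma_gt0.
- rewrite (_ : _ \_ _ = fun s => pker x (t - s) * (y \_ `]a, b[) s).
    by apply: measurable_funM => //; apply: measurable_pker_comp; exact: measurable_funB.
  apply/funext => s; rewrite !patchE !mem_setE !in_itv/= /pker subr_gt0.
  have [sa|as_] := leP s a; rewrite /= ?mulr0//.
  have [st|ts] := ltP s t; rewrite ?mul0r// (lt_le_trans st tb)//.
apply: eq_Rintegral => s _.
rewrite !patchE !mem_setE !in_itv/= /RLker /pker subr_gt0.
have [sa|as_] := leP s a; rewrite /= ?mulr0//.
have [st|ts] := ltP s t; rewrite ?(lt_le_trans st tb)/=; last by rewrite !mul0r mulr0.
by rewrite mulrA (mulrC _^-1).
Qed.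

Lemma continuous_RLker_gt0 x v : 0 < v -> {for v, continuous (RLker x)}.
Proof.
move=> v0; have cp : {for v, continuous (fun s : R => s `^ (x - 1) / Gamma x)}.
  apply: (@continuousM _ _ (fun s => s `^ (x - 1)) (cst (Gamma x)^-1)); last exact: cst_continuous.
  apply: differentiable_continuous; apply/derivable1_diffP.
  by apply: derivable_powR; rewrite in_itv/= andbT.
rewrite /prop_for /continuous_at /RLker pkerE//; apply: cvg_trans cp.
by apply: near_eq_cvg; near=> s; rewrite pkerE//; near: s; exact: lt_nbhsr.
Unshelve. all: by end_near. Qed.

(* The value at 1 of the derivative of I^1 (RLker x) = RLker (x + 1). *)
Lemma GammaS x : 0 < x -> Gamma (x + 1) = x * Gamma x.
Proof.
move=> x0.
have G0 := Gamma_gt0 _ x0.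
have x10 : 0 < x + 1 by rewrite addr_gt0.
have G1 := Gamma_gt0 _ x10.
have mk : measurable_fun setT (fun s : R => RLker x s) by exact: measurable_RLker_comp.
have intE t : 0 < t -> (\int[mu]_(s in `]0%R, t]) (RLker x s)%:E = (t `^ x / Gamma (x + 1))%:E)%E.
  move=> t0; have := RLker_conv 1 x t 0 ltr01 x0.
  rewrite subr0 (addrC 1 x) => H.
  transitivity (RLker (x + 1) t)%:E; last by rewrite /RLker pkerE// addrK.
  rewrite -[RHS]H.
  rewrite -integral_itv_bndo_bndc; last first.
    by apply/measurable_EFinP; exact: measurable_funTS.
  rewrite integral_mkcond; apply: eq_integral => s _.
  rewrite patchE mem_setE in_itv/= subr0 RLker1 subr_gt0.
  have [s0|s0] := leP s 0; first by rewrite le0_RLker//= mulr0.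
  by case: (s < t); [rewrite [in RHS]mul1r|rewrite [in RHS]mul0r].
have ki : mu.-integrable `]0, 2[ (EFin \o RLker x).
  apply: (@integrableS _ _ _ mu `]0, 2]) => //; first by apply: subset_itvl; rewrite bnd_simp.
  apply/integrableP; split.
    by apply/measurable_EFinP; exact: measurable_funTS.
  rewrite (_ : integral _ _ _ = (2 `^ x / Gamma (x + 1))%:E) ?ltry// -intE//.
  by apply: eq_integral => s _; rewrite gee0_abs// lee_fin RLker_ge0.
have ck := continuous_RLker_gt0 x _ (@ltr01 R).
have d1 : is_derive (1 : R) 1 (fun s => \int[mu]_(r in `]0, s]) RLker x r) (RLker x 1).
  by apply: (@is_derive_integral_itv _ 0 2) => //; rewrite ltr01 ltr1n.
have d2 : is_derive (1 : R) 1 (fun s => s `^ x / Gamma (x + 1)) (x / Gamma (x + 1)).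
  have := is_derive1_powR x (@ltr01 R) => /(@is_deriveZ _ _ _ _ (Gamma (x + 1))^-1).
  rewrite powR1 mulr1 [X in is_derive _ _ _ X]mulrC.
  by congr is_derive; apply/funext => s; rewrite /GRing.scale/= mulrC.
have d3 : is_derive (1 : R) 1 (fun s => s `^ x / Gamma (x + 1)) (RLker x 1).
  apply: near_eq_is_derive d1; near=> s.
  by rewrite /Rintegral intE//; near: s; exact: lt_nbhsr.
have : x / Gamma (x + 1) = RLker x 1.
  by case: d2 => _ <-; case: d3 => _ <-.
have -> : RLker x 1 = (Gamma x)^-1 by rewrite /RLker pkerE// powR1 mul1r.
move: (Gamma (x + 1)) (Gamma x) G1 G0 => B A B0 A0 E.
have -> : B = A^-1 * A * B by field; rewrite gt_eqF.
by rewrite -E; field; rewrite gt_eqF.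
Unshelve. all: by end_near. Qed.

Lemma continuous_RLker x : 0 < x -> continuous (RLker (x + 1)).
Proof.
move=> x0 v.
apply: (@continuousM _ _ (pker (x + 1)) (cst (Gamma (x + 1))^-1)); last exact: cst_continuous.
have [v0|v0|->] := ltgtP v 0.
- rewrite /prop_for /continuous_at le0_pker ?ltW//.
  apply: (@cvg_trans _ ((fun=> 0 : R) @ v)); last exact: (@cst_continuous _ _ (0 : R) v).
  apply: near_eq_cvg; near=> s; rewrite le0_pker//; apply: ltW.
  by near: s; exact: lt_nbhsl.
- rewrite /prop_for /continuous_at pkerE//.
  have cp : {for v, continuous (fun s : R => s `^ (x + 1 - 1))}.
    apply: differentiable_continuous; apply/derivable1_diffP.
    by apply: derivable_powR; rewrite in_itv/= andbT.
  apply: cvg_trans cp.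
  by apply: near_eq_cvg; near=> s; rewrite pkerE//; near: s; exact: lt_nbhsr.
- rewrite /prop_for /continuous_at le0_pker//; apply/cvgrPdist_lt => e e0.
  near=> s; rewrite sub0r normrN ger0_norm ?pker_ge0// /pker.
  case: ifPn => // s0; rewrite addrK.
  (* Writing e as (e^(1/x))^x shows that s^x < e as soon as s < e^(1/x). *)
  rewrite -[ltRHS](powRr1 (ltW e0)) -(mulVf (lt0r_neq0 x0)) powRrM.
  rewrite gt0_ltr_powR ?nnegrE ?powR_ge0 ?ltW//.
  by near: s; apply: lt_nbhsl; exact: powR_gt0.
Unshelve. all: by end_near. Qed.

(** Dominated convergence for t in ]v - 1, v + 1[: the order exceeds 1, so the kernel is continuous
    and, for s > a, at most the constant [M]. *)
Lemma continuous_RLint x a f : 0 < x -> (forall r, r <= a -> f r = 0) ->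
  mu.-integrable setT (EFin \o f) -> continuous (RLint (x + 1) f).
Proof.
move=> x0 f0 fi v.
have x11 : 1 <= x + 1 by rewrite lerDr ltW.
have x10 : 0 < x + 1 by exact: lt_le_trans x11.
have mf : measurable_fun setT f by apply/measurable_EFinP; exact: measurable_int fi.
pose L := `|v + 1 - a|; pose M := L `^ (x + 1 - 1) / Gamma (x + 1).
have M0 : 0 <= M by rewrite mulr_ge0 ?powR_ge0// invr_ge0 ltW// Gamma_gt0.
have mK l : measurable_fun setT (fun s : R => RLker (x + 1) (l - s) * f s).
  by apply: measurable_funM => //; exact: measurable_RLkerB.
have Mfi : mu.-integrable setT (EFin \o (fun s => M * `|f s|)).
  have := integrable_norm fi => /(integrableZl measurableT M).
  by apply: eq_integrable.
have bnd l s : l < v + 1 -> `|RLker (x + 1) (l - s) * f s| <= M * `|f s|.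
  move=> lv; rewrite [leLHS]normrM.
  have [sa|sa] := leP s a; first by rewrite f0// normr0 !mulr0.
  rewrite ler_wpM2r// ger0_norm ?RLker_ge0//; apply: RLker_le => //; first exact: normr_ge0.
  by apply: (le_trans _ (ler_norm (v + 1 - a))); apply: lerB; exact: ltW.
apply: (@continuity_under_integral R _ _ mu
  (fun l s => RLker (x + 1) (l - s) * f s) setT measurableT (v - 1) (v + 1)
  _ _ (fun s => M * `|f s|)) => //.
- move=> l /=; rewrite in_itv/= => /andP[_ lv].
  apply: le_integrable Mfi => //; first by apply/measurable_EFinP; exact: mK.
  by move=> s _; rewrite /= lee_fin (ger0_norm (mulr_ge0 M0 _))// bnd.
- apply: aeW => s _ l _.
  apply: (@continuousM _ _ (fun l => RLker (x + 1) (l - s)) (cst (f s))); last exact: cst_continuous.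
  apply: (@continuous_comp _ _ _ (fun l => l - s) (RLker (x + 1))); last exact: continuous_RLker.
  by apply: continuousB => //; exact: cst_continuous.
- move=> l /=; rewrite in_itv/= => /andP[_ lv].
  by apply: aeW => s _; exact: bnd.
- by rewrite inE/= in_itv/= ltrBlDr ltrDl ltr01.
Qed.

End RLint_facts.

(** * Measurability, locality and linearity of fractional integrals *)

Section RLint_linear.
Context {R : realType}.
Implicit Types (x a b t c d : R) (f g : R -> R).
Notation mu := (@lebesgue_measure R).

(** Tonelli applies to the positive and negative parts separately, so that points where the integral
    diverges are included. *)
Lemma measurable_RLint x f : measurable_fun setT f -> measurable_fun setT (RLint x f).
Proof.
move=> mf.
pose F (z : measurableTypeR R * measurableTypeR R) : \bar R :=
  (RLker x (z.1 - z.2) * f z.2)%:E.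
have mF : measurable_fun setT F.
  apply/measurable_EFinP; apply: measurable_funM; last exact: measurableT_comp.
  by apply: measurable_RLker_comp; exact: measurable_funB.
have mI : measurable_fun setT (fun s => (\int[mu]_r F (s, r))%E).
  rewrite (_ : (fun s => _) =
    (fun s => (\int[mu]_r F^\+ (s, r))%E - (\int[mu]_r F^\- (s, r))%E)%E).
    apply: emeasurable_funB.
      by apply: (measurable_fun_fubini_tonelli_F F^\+)%E => //; exact: measurable_funepos.
    by apply: (measurable_fun_fubini_tonelli_F F^\-)%E => //; exact: measurable_funeneg.
  apply/funext => s; rewrite [LHS]integralE.
  by congr (_ - _)%E; apply: eq_integral => r _; rewrite unlock.
exact: (measurableT_comp _ mI).
Qed.

Lemma eq_RLint x t f g : (forall s, s < t -> f s = g s) -> RLint x f t = RLint x g t.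
Proof.
move=> fg; apply: eq_Rintegral => s _.
have [st|ts] := ltP s t; first by rewrite fg.
by rewrite le0_RLker ?subr_le0// !mul0r.
Qed.

Lemma RLint_le0 x a t f : (forall r, r <= a -> f r = 0) -> t <= a -> RLint x f t = 0.
Proof.
move=> f0 ta; transitivity (\int[mu]_(s in setT) (0 : R)); last by rewrite Rintegral_cst// mul0r.
apply: eq_Rintegral => s _.
have [sa|as_] := leP s a; first by rewrite f0// mulr0.
by rewrite le0_RLker ?mul0r// subr_le0 (le_trans ta)// ltW.
Qed.

Lemma RL_integrable_lin x t c d f g : RL_integrable x t f -> RL_integrable x t g ->
  RL_integrable x t (fun s => c * f s + d * g s).
Proof.
move=> fi gi.
have := integrableD measurableT (integrableZl measurableT c fi) (integrableZl measurableT d gi).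
apply: eq_integrable => // s _ /=; rewrite -!EFinM -EFinD; congr EFin; ring.
Qed.

Lemma RLint_lin x t c d f g : RL_integrable x t f -> RL_integrable x t g ->
  RLint x (fun s => c * f s + d * g s) t = c * RLint x f t + d * RLint x g t.
Proof.
move=> fi gi; rewrite /RLint -!RintegralZl// -RintegralD//.
- by apply: eq_Rintegral => s _; ring.
- by apply: eq_integrable (integrableZl measurableT c fi).
- by apply: eq_integrable (integrableZl measurableT d gi).
Qed.

Lemma RL_integrable_RLker x y t a : 0 < x -> 0 < y -> RL_integrable x t (fun s => RLker y (s - a)).
Proof.
move=> x0 y0; apply/integrableP; split.
  apply/measurable_EFinP; apply: measurable_funM; first exact: measurable_RLkerB.
  by apply: measurable_RLker_comp; exact: measurable_funB.
rewrite [X in (X < _)%E](_ : _ = (RLker (x + y) (t - a))%:E) ?ltry//.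
rewrite -RLker_conv//; apply: eq_integral => s _.
by rewrite gee0_abs// lee_fin mulr_ge0// RLker_ge0.
Qed.

Lemma RLint_RLker x y t a : 0 < x -> 0 < y ->
  RLint x (fun s => RLker y (s - a)) t = RLker (x + y) (t - a).
Proof. by move=> x0 y0; rewrite /RLint /Rintegral RLker_conv. Qed.

Lemma RL_integrable1_integrable a b f : RL_integrable 1 b f -> mu.-integrable `]a, b[ (EFin \o f).
Proof.
move=> fi; have : mu.-integrable `]a, b[ (fun s : R => (RLker 1 (b - s) * f s)%:E).
  exact: integrableS fi.
apply: eq_integrable => // s; rewrite inE/= in_itv/= => /andP[_ sb].
by rewrite RLker1 subr_gt0 sb mul1r.
Qed.

End RLint_linear.

(** * Abel inversion *)

Section Abel_inversion.
Context {R : realType}.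
Implicit Types (a b t c beta : R) (f g y u : R -> R).
Notation mu := (@lebesgue_measure R).

(** With v = c - I^1 f, u is c + I^1 v, and the constant c is c times [RLker 1 (s - a)] for s > a.
    Since I^beta I^1 v = I^1 I^beta v, I^beta u is I^1 of g, where g contains I^beta v. Both sides
    of the conclusion are thus ordinary integrals, ready to be differentiated. The coefficients 1
    and -1 fit the shape of [RLint_lin]. *)
Lemma RLint1_Abel a b c beta y u f : 0 < beta ->
  measurable_fun setT f -> (forall r, r <= a -> f r = 0) ->
  mu.-integrable setT (EFin \o f) ->
  (forall s, s <= a -> u s = 0) ->
  (forall s, a < s < b ->
    u s = c + RLint 1 (fun r => c * RLker 1 (r - a) + -1 * RLint 1 f r) s) ->
  (forall t, a < t < b -> RLint beta u t = RLint 1 y t) ->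
  let g s := c * RLker beta (s - a) +
    1 * (c * RLker (beta + 1) (s - a) + -1 * RLint (beta + 1) f s) in
  RL_integrable 1 b g /\ forall t, a < t < b -> RLint 1 y t = RLint 1 g t.
Proof.
move=> beta0 mf f0 fi u0 uE Iu g.
have beta1 : 1 <= beta + 1 by rewrite lerDr ltW.
have beta1' : 1 <= 1 + beta by rewrite lerDl ltW.
have beta10 : 0 < beta + 1 by rewrite addr_gt0.
have fi' t : mu.-integrable `]a, t[ (EFin \o f) by exact: integrableS fi.
pose h s := c * RLker (beta + 1) (s - a) + -1 * RLint (beta + 1) f s.
have hok t : RL_integrable 1 t h.
  apply: RL_integrable_lin; first exact: RL_integrable_RLker.
  by apply: (RLint_semigroup 1 (beta + 1) a t f _ _ _ mf f0 (fi' t)).1 => //; rewrite lerDl ltW.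
have gok t : RL_integrable 1 t g by apply: RL_integrable_lin => //; exact: RL_integrable_RLker.
split => // t tab; have /andP[a_t tb] := tab.
pose v r := c * RLker 1 (r - a) + -1 * RLint 1 f r.
have mv : measurable_fun setT v.
  apply: measurable_funD; apply: measurable_funM => //.
    by apply: measurable_RLker_comp; exact: measurable_funB.
  exact: measurable_RLint.
have v0 r : r <= a -> v r = 0.
  by move=> ra; rewrite /v le0_RLker ?subr_le0// (RLint_le0 _ a)// !mulr0 addr0.
have two : 1 <= 1 + 1 :> R by rewrite lerDl.
have vok s : RL_integrable 1 s v.
  apply: RL_integrable_lin; first exact: RL_integrable_RLker.
  by apply: (RLint_semigroup 1 1 a s f _ _ two mf f0 (fi' s)).1.
have vi s := RL_integrable1_integrable a s v (vok s).
have [vb vbE] := RLint_semigroup beta 1 a t v beta0 ltr01 beta1 mv v0 (vi t).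
have [_ vbE'] := RLint_semigroup 1 beta a t v ltr01 beta0 beta1' mv v0 (vi t).
have bv s : RLint beta v s = h s.
  have [fok fE] := RLint_semigroup beta 1 a s f beta0 ltr01 beta1 mf f0 (fi' s).
  by rewrite (RLint_lin _ _ _ _ _ _ (RL_integrable_RLker _ _ _ _ beta0 ltr01) fok) fE RLint_RLker.
rewrite -Iu// (eq_RLint _ _ _ (fun s => c * RLker 1 (s - a) + 1 * RLint 1 v s)); last first.
  move=> s st; have [sa|as_] := leP s a.
    by rewrite u0// le0_RLker ?subr_le0// (RLint_le0 _ a)// !mulr0 addr0.
  by rewrite uE ?as_ ?(lt_trans st)// RLker1 subr_gt0 as_ mulr1 mul1r.
rewrite (RLint_lin _ _ _ _ _ _ (RL_integrable_RLker _ _ _ _ beta0 ltr01) vb) RLint_RLker//.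
rewrite (RLint_lin _ _ _ _ _ _ (RL_integrable_RLker _ _ _ _ ltr01 beta0) (hok t)) RLint_RLker//.
rewrite vbE (addrC beta 1) -vbE'; congr (_ + _ * _).
exact: eq_RLint.
Qed.

(** Equal primitives have equal derivatives at a common point of continuity. *)
Lemma eq_RLint1 a b y g :
  measurable_fun setT y -> measurable_fun setT g ->
  (forall r, r <= a -> y r = 0) -> (forall r, r <= a -> g r = 0) ->
  mu.-integrable `]a, b[ (EFin \o y) -> mu.-integrable `]a, b[ (EFin \o g) ->
  (forall t, a < t < b -> RLint 1 y t = RLint 1 g t) ->
  forall t, a < t < b -> {for t, continuous y} -> {for t, continuous g} -> y t = g t.
Proof.
move=> my mg y0 g0 yi gi yg t tab cy cg; have /andP[a_t tb] := tab.
have dy := is_derive_integral_itv a b t y tab yi cy.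
have dg := is_derive_integral_itv a b t g tab gi cg.
have dy' : is_derive t 1 (fun s => \int[mu]_(r in `]a, s]) g r) (y t).
  apply: near_eq_is_derive dy; near=> s.
  rewrite -!RLint1E// yg//; apply/andP; split; near: s.
    exact: lt_nbhsr.
  exact: lt_nbhsl.
by case: dy' => _ <-; case: dg => _ <-.
Unshelve. all: by end_near. Qed.

End Abel_inversion.

(** * Integral representation of the solutions *)

Section solution.
Context {R : realType}.
Implicit Types (a b t c alpha beta : R) (f p y u : R -> R).
Notation mu := (@lebesgue_measure R).

Lemma RL_order_eq1 beta : 0 < beta <= 1 -> RL_order beta = 1%N.
Proof. by move=> h; rewrite /RL_order (ceil_def (m := 1))// subrr. Qed.

Lemma RL_order_eq2 beta : 1 < beta <= 2 -> RL_order beta = 2%N.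
Proof. by move=> h; rewrite /RL_order (ceil_def (m := 2)). Qed.

Lemma integrable_mul_continuous a b p y : a < b ->
  {within `[a, b], continuous p} ->
  mu.-integrable `]a, b[ (EFin \o y) ->
  mu.-integrable `]a, b[ (EFin \o (fun s => p s * y s)).
Proof.
move=> ab cp yi.
have /compact_bounded [M [_ pM]] := continuous_compact cp (@segment_compact R a b).
have mp : measurable_fun `]a, b[ p.
  apply: open_continuous_measurable_fun; first exact: interval_open.
  by have /(continuous_within_itvP _ ab)[cpi _ _] := cp; move=> t; rewrite inE; exact: cpi.
have bp : [bounded p x | x in `]a, b[].
  exists M; split; first exact: num_real.
  by move=> N MN t tab; apply: pM => //; exists t => //; exact: subset_itv_oo_cc tab.
have H : mu.-integrable `]a, b[ ((EFin \o p) \* (EFin \o y))%E by exact: integrableMr.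
by apply: eq_integrable H.
Qed.

Lemma solution_representation a b alpha p y : a < b -> 1 < alpha -> alpha <= 2 ->
  {within `[a, b], continuous p} -> is_solution a b alpha p y ->
  let f := (fun s => p s * y s) \_ (`]a, b[%classic) in
  exists c,
    (forall t, a < t <= b -> y t = c * RLker (alpha - 1) (t - a) +
       (c * RLker alpha (t - a) - RLint alpha f t)) /\
    - y b = c - RLint 1 f b.
Proof.
move=> ab alpha1 alpha2 cp [cy yi dy eqy [Ia [Da [uIa uDa IaDa]]] [Db uDb yDb]] f.
have beta0 : 0 < alpha - 1 by rewrite subr_gt0.
have beta1 : alpha - 1 <= 1 by rewrite lerBlDr.
(* The orders of alpha and alpha - 1 are 2 and 1, so the two fractional derivatives are u'' and u'
   for the same u. *)
move: dy eqy uIa uDa uDb; rewrite /RL_derivable /RL_derivative.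
rewrite RL_order_eq2 ?alpha1// RL_order_eq1 ?beta0//.
rewrite (_ : 1 - (alpha - 1) = 2 - alpha); last by ring.
set u := RL_integral a (2 - alpha) y => dy eqy uIa uDa uDb.
have pyi := integrable_mul_continuous _ _ _ _ ab cp yi.
have fi : mu.-integrable setT (EFin \o f).
  by rewrite /f -restrict_EFin; apply/integrable_restrict => //=; rewrite setTI.
have mf : measurable_fun setT f by apply/measurable_EFinP; exact: measurable_int fi.
have f0 r : r <= a -> f r = 0.
  by move=> ra; rewrite /f patchE mem_setE in_itv/= ltNge ra.
pose y0 := y \_ `]a, b[.
have y0i : mu.-integrable setT (EFin \o y0).
  by rewrite /y0 -restrict_EFin; apply/integrable_restrict => //=; rewrite setTI.
have my0 : measurable_fun setT y0 by apply/measurable_EFinP; exact: measurable_int y0i.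
have y00 r : r <= a -> y0 r = 0.
  by move=> ra; rewrite /y0 patchE mem_setE in_itv/= ltNge ra.
have y0E t : a < t < b -> y0 t = y t.
  by move=> tab; rewrite /y0 patchE mem_setE in_itv/= tab.
have fE t : t < b -> \int[mu]_(s in `]a, t]) (p s * y s) = RLint 1 f t.
  move=> tb; rewrite (RLint1E a)//; apply: eq_Rintegral => s.
  rewrite inE/= in_itv/= => /andP[as_ st].
  by rewrite /f patchE mem_setE in_itv/= as_ (le_lt_trans st).
have DaE : Da = Ia by apply/eqP; rewrite eq_sym -subr_eq0 IaDa.
have pc t : a < t < b -> {for t, continuous p}.
  by move=> tab; have /(continuous_within_itvP _ ab)[cpi _ _] := cp; apply: cpi; rewrite in_itv.
have yc t : a < t < b -> {for t, continuous y}.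
  move=> tab; have cyo : {within `]a, b[, continuous y}.
    by apply: continuous_subspaceW cy; apply: subset_itvl; rewrite bnd_simp.
  move: cyo; rewrite continuous_open_subspace; last exact: interval_open.
  by apply; rewrite inE/= in_itv.
have pyc t : a < t < b -> {for t, continuous (fun s => - (p s * y s))}.
  move=> tab; apply: (@continuousN _ _ _ (fun s => p s * y s)).
  by apply: continuousM; [exact: pc|exact: yc].
have du' t : a < t < b -> is_derive t 1 (derive1 u) (- (p t * y t)).
  move=> tab; have tin : t \in `]a, b[ by rewrite in_itv.
  have := eqy t tin => /eqP; rewrite addr_eq0 => /eqP <-.
  rewrite /= derive1E; apply: derivableP.
  exact: (dy 1%N).
have npyi : mu.-integrable `]a, b[ (EFin \o (fun s => - (p s * y s))).
  have := integrableN pyi.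
  by apply: eq_integrable.
have u'E := primitive_from_left _ _ _ _ _ ab du' pyc npyi uDa.
have u'E' t : a < t < b -> (derive1 u) t = Ia * RLker 1 (t - a) + -1 * RLint 1 f t.
  move=> tab; have /andP[a_t tb] := tab.
  rewrite u'E// DaE RLker1 subr_gt0 a_t mulr1 -fE//; congr (_ + _).
  rewrite -RintegralZl//; last first.
    by apply: integrableS pyi => //; apply: subset_itvl; rewrite bnd_simp.
  by apply: eq_Rintegral => s _; rewrite mulN1r.
have vok : RL_integrable 1 b (fun t => Ia * RLker 1 (t - a) + -1 * RLint 1 f t).
  apply: RL_integrable_lin; first exact: RL_integrable_RLker.
  apply: (RLint_semigroup 1 1 a b f _ _ _ mf f0 (integrableS _ _ _ fi)).1 => //.
  by rewrite lerDl.
have u'i : mu.-integrable `]a, b[ (EFin \o (derive1 u)).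
  have := RL_integrable1_integrable a b _ vok.
  by apply: eq_integrable => // t; rewrite inE/= in_itv/= => tab; rewrite u'E'.
have u'c t : a < t < b -> {for t, continuous (derive1 u)}.
  move=> /du'[d _]; apply: differentiable_continuous; exact/derivable1_diffP.
have du t : a < t < b -> is_derive t 1 u ((derive1 u) t).
  move=> tab; have tin : t \in `]a, b[ by rewrite in_itv.
  rewrite derive1E; apply: derivableP; exact: (dy 0%N).
have uE := primitive_from_left _ _ _ _ _ ab du u'c u'i uIa.
have fbE : RLint 1 f b = \int[mu]_(s in `]a, b[) (p s * y s).
  rewrite (RLint1E a)// -Rintegral_itv_bndo_bndc; last exact: integrableS fi.
  by apply: eq_Rintegral => s; rewrite /f patchE => ->.
exists Ia; split; last first.
  have -> : - y b = Db by apply/esym/eqP; rewrite -addr_eq0 addrC yDb.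
  have H : derive1 u t @[t --> b^'-] --> Da + \int[mu]_(s in `]a, b[) (- (p s * y s)).
    apply: (@cvg_trans _ ((Da + \int[mu]_(s in `]a, t]) (- (p s * y s))) @[t --> b^'-])).
      apply: near_eq_cvg; near=> t; rewrite u'E//; apply/andP; split; near: t.
        exact: nbhs_left_gt.
      exact: nbhs_left_lt.
    apply: cvgD; first exact: cvg_cst.
    exact: integral_itv_cvg_right ab npyi.
  rewrite (cvg_unique _ uDb H)// DaE fbE; congr (_ + _).
  rewrite -mulN1r -RintegralZl//.
  by apply: eq_Rintegral => s _; rewrite mulN1r.
pose u0 := u \_ `]a, b[.
have u0E t : a < t < b -> u0 t = u t.
  by move=> tab; rewrite /u0 patchE mem_setE in_itv/= tab.
have u00 r : r <= a -> u0 r = 0.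
  by move=> ra; rewrite /u0 patchE mem_setE in_itv/= ltNge ra.
have Iu t : a < t < b -> RLint (alpha - 1) u0 t = RLint 1 y0 t.
  move=> tab; have /andP[a_t tb] := tab.
  (* For alpha = 2 the operator I^0 is the identity by convention and is not given by a kernel; the
     semigroup law is used only for 2 - alpha > 0. *)
  move: alpha2; rewrite le_eqVlt => /predU1P[a2|alpha_lt2].
    have -> : u0 = y0 by rewrite /u0 /u /RL_integral a2 subrr eqxx.
    have -> : alpha - 1 = 1 by rewrite a2; ring.
    by [].
  have gamma0 : 0 < 2 - alpha by rewrite subr_gt0.
  have E1 : 1 = alpha - 1 + (2 - alpha) by ring.
  have [||_ SE] := RLint_semigroup (alpha - 1) (2 - alpha) a t y0 beta0 gamma0 _ my0 y00 _.
  - by rewrite -E1.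
  - exact: integrableS y0i.
  rewrite [in RHS]E1 -SE; apply: eq_RLint => s st.
  have [sa|as_] := leP s a; first by rewrite (u00 _ sa) (RLint_le0 _ _ _ _ y00 sa).
  have sb : s < b by exact: lt_trans st tb.
  have sab : a < s < b by apply/andP.
  rewrite (u0E _ sab); exact: (RL_integralE a b s (2 - alpha) y gamma0 (ltW sb) my0).
pose v t := Ia * RLker 1 (t - a) + -1 * RLint 1 f t.
have mv : measurable_fun setT v.
  apply: measurable_funD; apply: measurable_funM => //.
    by apply: measurable_RLker_comp; exact: measurable_funB.
  exact: measurable_RLint.
have v0 r : r <= a -> v r = 0.
  by move=> ra; rewrite /v le0_RLker ?subr_le0// (RLint_le0 _ a)// !mulr0 addr0.
have u0v s : a < s < b -> u0 s = Ia + RLint 1 v s.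
  move=> sab; have /andP[_ sb] := sab.
  rewrite u0E// uE// (RLint1E a)//; congr (_ + _); apply: eq_Rintegral => r.
  by rewrite inE/= in_itv/= => /andP[ar rs]; rewrite u'E'// ar (le_lt_trans rs).
have := RLint1_Abel a b Ia (alpha - 1) y0 u0 f beta0 mf f0 fi u00 u0v Iu.
rewrite /= !subrK; set g := (X in RL_integrable 1 b X); move=> [gok gE].
have g0 r : r <= a -> g r = 0.
  by move=> ra; rewrite /g !le0_RLker ?subr_le0// (RLint_le0 _ a)// !(mulr0, addr0).
have mK x : measurable_fun setT (fun s : R => RLker x (s - a)).
  by apply: measurable_RLker_comp; exact: measurable_funB.
have mcM (k : R) h : measurable_fun setT h -> measurable_fun setT (fun s : R => k * h s).
  by move=> mh; apply: measurable_funM => //; exact: measurable_cst.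
have mg : measurable_fun setT g.
  apply: measurable_funD; first exact: mcM (mK _).
  apply: (mcM _ _); apply: measurable_funD; first exact: mcM (mK _).
  exact: mcM (measurable_RLint _ _ mf).
have cK x t : a < t -> {for t, continuous (fun s => RLker x (s - a))}.
  move=> a_t; apply: (@continuous_comp _ _ _ (fun s => s - a) (RLker x)).
    by apply: continuousB => //; exact: cst_continuous.
  by apply: continuous_RLker_gt0; rewrite subr_gt0.
have cI : continuous (RLint alpha f).
  by have := continuous_RLint (alpha - 1) a f beta0 f0 fi; rewrite subrK.
have cg t : a < t -> {for t, continuous g}.
  move=> a_t; apply: continuousD.
    by apply: continuousM; [exact: cst_continuous|exact: cK].
  apply: continuousM; first exact: cst_continuous.
  apply: continuousD; first by apply: continuousM; [exact: cst_continuous|exact: cK].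
  by apply: continuousM; [exact: cst_continuous|exact: cI].
have yg t : a < t < b -> y t = g t.
  move=> tab; have /andP[a_t tb] := tab; rewrite -y0E//.
  apply: (eq_RLint1 a b) => //; last exact: cg.
  - exact: integrableS y0i.
  - exact: RL_integrable1_integrable.
  - rewrite /prop_for /continuous_at y0E//; apply: cvg_trans (yc _ tab).
    apply: near_eq_cvg; near=> s; rewrite y0E//; apply/andP; split; near: s.
      exact: lt_nbhsr.
    exact: lt_nbhsl.
move=> t /andP[a_t]; rewrite le_eqVlt => /predU1P[->|tb]; last first.
  by rewrite yg ?a_t// /g mul1r mulN1r.
(* Differentiation only reaches t < b; the endpoint follows from left continuity of [y] and [g] at
   b. *)
have ygb : y b = g b.
  have yb : y t @[t --> b^'-] --> y b.
    have mb : (a + b) / 2 < b by rewrite midf_lt.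
    have : {within `[(a + b) / 2, b], continuous y}.
      by apply: continuous_subspaceW cy; apply: subset_itvr; rewrite bnd_simp midf_lt.
    by move=> /(continuous_within_itvP _ mb)[].
  have gb : g t @[t --> b^'-] --> g b by apply: cvg_at_left_filter; exact: cg.
  suff yb' : y t @[t --> b^'-] --> g b by exact: cvg_unique yb yb'.
  apply: cvg_trans gb; apply: near_eq_cvg; near=> s; rewrite yg//; apply/andP; split; near: s.
    exact: nbhs_left_gt.
  exact: nbhs_left_lt.
by rewrite ygb /g mul1r mulN1r.
Unshelve. all: by end_near. Qed.

End solution.

(** * The Lyapunov inequality *)

Section kernel_bounds.
Context {R : realType}.
Implicit Types (a b s t x v w beta : R).

Lemma RLkerE x v : 0 < v -> RLker x v = v `^ (x - 1) / Gamma x.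
Proof. by move=> v0; rewrite /RLker pkerE. Qed.

Lemma RLker_sum beta x : 0 < beta -> 0 < x ->
  RLker beta x + RLker (beta + 1) x =
  x `^ (beta - 1) * (beta + x) / Gamma (beta + 1).
Proof.
move=> beta0 x0; rewrite /RLker !pkerE// addrK -(mulr_powRB1 (ltW x0) beta0) GammaS//.
have := Gamma_gt0 _ beta0; move: (Gamma beta) => G G0.
by field; rewrite !gt_eqF.
Qed.

(** For s < t everything rests on two facts: (t - a)(b - s) - (t - s)(b - a) = (b - t)(s - a) >= 0,
    raised to the power beta, and the monotonicity of (beta + x) / x, which decreases in x. For t <=
    s the left-hand side is 0. *)
Lemma green_kernel_ge0 beta a b s t : 0 < beta -> a < s -> s < b -> a < t -> t <= b ->
  RLker (beta + 1) (t - s) *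
    (RLker beta (b - a) + RLker (beta + 1) (b - a) + 1) <=
  (RLker beta (t - a) + RLker (beta + 1) (t - a)) *
    (RLker (beta + 1) (b - s) + RLker 1 (b - s)).
Proof.
move=> beta0 as_ sb a_t tb.
have b10 : 0 < beta + 1 by rewrite addr_gt0.
have [st|ts] := ltP s t; last first.
  by rewrite le0_RLker ?subr_le0// mul0r mulr_ge0// addr_ge0// RLker_ge0.
have x0 : 0 < t - a by rewrite subr_gt0.
have L0 : 0 < b - a by rewrite subr_gt0 (lt_le_trans a_t).
rewrite (RLker_sum _ _ beta0 x0) (RLker_sum _ _ beta0 L0) RLker1 subr_gt0 sb.
rewrite /RLker !pkerE ?subr_gt0// !addrK.
have := Gamma_gt0 _ b10; move: (Gamma (beta + 1)) => G G0.
have y0 : 0 < t - s by rewrite subr_gt0.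
have z0 : 0 < b - s by rewrite subr_gt0.
have E v : 0 < v -> v `^ (beta - 1) = v `^ beta / v.
  by move=> v0; rewrite -(mulr_powRB1 (ltW v0) beta0); field; rewrite gt_eqF.
rewrite !E//.
have H1 : (t - s) `^ beta <= (t - a) `^ beta.
  by apply: ge0_ler_powR; [exact: ltW|rewrite nnegrE ltW|rewrite nnegrE ltW|rewrite lerB// ltW].
have H2 : (t - s) `^ beta * (b - a) `^ beta <= (t - a) `^ beta * (b - s) `^ beta.
  rewrite -!powRM; try exact: ltW.
  apply: ge0_ler_powR; [exact: ltW|by rewrite nnegrE mulr_ge0// ltW|by rewrite nnegrE mulr_ge0// ltW|].
  rewrite -subr_ge0 (_ : _ - _ = (b - t) * (s - a)); last by ring.
  by rewrite mulr_ge0 ?subr_ge0// ltW.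
have H3 : (beta + (b - a)) / (b - a) <= (beta + (t - a)) / (t - a).
  rewrite (mulrDl beta (b - a)) (mulrDl beta (t - a)) !divff ?gt_eqF// lerD2r ler_wpM2l//; first exact: ltW.
  by rewrite lef_pV2 ?posrE// lerB.
have p1 := powR_ge0 (t - s) beta; have p2 := powR_ge0 (b - a) beta.
have p3 := powR_ge0 (t - a) beta; have p4 := powR_ge0 (b - s) beta.
move: H1 H2 H3 p1 p2 p3 p4.
move: ((t - s) `^ beta) ((b - a) `^ beta) ((t - a) `^ beta) ((b - s) `^ beta) => Y L X Z.
move: x0 L0; move: (t - a) (b - a) => x l x0 l0 H1 H2 H3 Y0 L0 X0 Z0.
have H4 : Y * L * ((beta + l) / l) <= X * Z * ((beta + x) / x).
  by apply: ler_pM => //; rewrite ?mulr_ge0// ?invr_ge0 ?addr_ge0// ltW.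
have H5 : Y <= X * ((beta + x) / x).
  apply: (le_trans H1); rewrite ler_peMr// mulrDl divff ?gt_eqF// lerDr.
  by rewrite divr_ge0// ltW.
(* Both sides split into a term over G^2 and a term over G, compared separately by [H4] and [H5]. *)
rewrite (_ : Y / G * (L / l * (beta + l) / G + 1) =
  (Y * L * ((beta + l) / l)) / G ^+ 2 + Y / G); last by field; rewrite !gt_eqF.
rewrite (_ : X / x * (beta + x) / G * (Z / G + 1) =
  (X * Z * ((beta + x) / x)) / G ^+ 2 + X * ((beta + x) / x) / G); last by field; rewrite !gt_eqF.
have G2 : 0 <= (G ^+ 2)^-1 by rewrite invr_ge0 exprn_ge0// ltW.
have G1 : 0 <= G^-1 by rewrite invr_ge0 ltW.
by apply: lerD; apply: ler_wpM2r.
Qed.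

Lemma RLker_lt beta v w : 0 < beta -> 0 < v -> v < w -> RLker (beta + 1) v < RLker (beta + 1) w.
Proof.
move=> beta0 v0 vw; have w0 : 0 < w by exact: lt_trans vw.
rewrite /RLker !pkerE// addrK ltr_pM2r ?invr_gt0 ?Gamma_gt0 ?addr_gt0//.
by apply: gt0_ltr_powR; rewrite // nnegrE ltW.
Qed.

End kernel_bounds.

(** * From kernel bounds to the strict inequality *)

Section lyapunov.
Context {R : realType}.
Implicit Types (a b s t c x k beta : R) (f g p y : R -> R).
Notation mu := (@lebesgue_measure R).

Lemma RLint_le x t f g : 0 < x -> RL_integrable x t f -> RL_integrable x t g ->
  (forall s, f s <= g s) -> RLint x f t <= RLint x g t.
Proof.
move=> x0 fi gi fg; apply: le_Rintegral => // s _.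
by rewrite ler_wpM2l ?RLker_ge0.
Qed.

Lemma RL_integrableZ x t k f : RL_integrable x t f -> RL_integrable x t (fun s => k * f s).
Proof.
move=> /(integrableZl measurableT k); apply: eq_integrable => // s _.
by rewrite -EFinM mulrCA.
Qed.

Lemma RLintZ x t k f : RL_integrable x t f -> RLint x (fun s => k * f s) t = k * RLint x f t.
Proof.
move=> fi; rewrite /RLint -RintegralZl//.
by apply: eq_Rintegral => s _; rewrite mulrCA.
Qed.

(** The coefficient of f is k (B + C) - E with 0 <= E <= k (B + C), so its absolute value is at most
    k (B + C). This is where nonnegativity of the Green kernel enters. *)
Lemma le_normr_RLint_comb x a b t k f : 0 < x -> 0 <= k ->
  RL_integrable x b f -> RL_integrable 1 b f -> RL_integrable x t f ->
  RL_integrable x b (fun s => `|f s|) -> RL_integrable 1 b (fun s => `|f s|) ->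
  (forall s, ~~ (a < s < b) -> f s = 0) ->
  (forall s, a < s < b -> RLker x (t - s) <= k * (RLker x (b - s) + RLker 1 (b - s))) ->
  `|k * RLint x f b + (k * RLint 1 f b - RLint x f t)| <=
  k * (RLint x (fun s => `|f s|) b + RLint 1 (fun s => `|f s|) b).
Proof.
move=> x0 k0 fb f1 ft nb n1 f0 kK.
have fbk := integrableZl measurableT k fb.
have f1k := integrableZl measurableT k f1.
have nbk := integrableZl measurableT k nb.
have n1k := integrableZl measurableT k n1.
have Bi := integrableB measurableT f1k ft.
have Di := integrableD measurableT fbk Bi.
have Ni := integrableD measurableT nbk n1k.
have -> : k * RLint x f b + (k * RLint 1 f b - RLint x f t) =
    \int[mu]_s (k * (RLker x (b - s) * f s) +
      (k * (RLker 1 (b - s) * f s) - RLker x (t - s) * f s)).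
  rewrite (RintegralD measurableT fbk Bi) (RintegralB measurableT f1k ft).
  by rewrite (RintegralZl _ measurableT fb) (RintegralZl _ measurableT f1).
have -> : k * (RLint x (fun s => `|f s|) b + RLint 1 (fun s => `|f s|) b) =
    \int[mu]_s (k * (RLker x (b - s) * `|f s|) + k * (RLker 1 (b - s) * `|f s|)).
  rewrite (RintegralD measurableT nbk n1k) mulrDr.
  by rewrite (RintegralZl _ measurableT nb) (RintegralZl _ measurableT n1).
apply: (le_trans (le_normr_Rintegral measurableT Di)).
apply: le_Rintegral => //; first exact: integrable_norm.
move=> s _; have := kK s; have := f0 s; have := RLker_ge0 x (t - s) x0.
move: (RLker x (b - s)) (RLker 1 (b - s)) (RLker x (t - s)) (f s) => B C E z E0 z0 kE.
have [sab|/z0 ->] := boolP (a < s < b); last first.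
  by rewrite normr0 !mulr0 subrr addr0 normr0.
have EB := kE sab.
have -> : k * (B * z) + (k * (C * z) - E * z) = (k * (B + C) - E) * z by ring.
have -> : k * (B * `|z|) + k * (C * `|z|) = k * (B + C) * `|z| by ring.
by rewrite normrM ger0_norm ?subr_ge0// ler_wpM2r// gerBl.
Qed.

(** For s < b, Q(s) is [RLker (beta + 1) (b - s) + RLker 1 (b - s)]; integrals against Q are
    therefore sums of fractional integrals of orders beta + 1 and 1 at b. *)
Lemma lyapunov_bound a b beta p y c : a < b -> 0 < beta ->
  {within `[a, b], continuous p} ->
  mu.-integrable `]a, b[ (EFin \o y) ->
  let f := (fun s => p s * y s) \_ (`]a, b[%classic) in
  (forall t, a < t <= b -> y t = c * RLker beta (t - a) +
     (c * RLker (beta + 1) (t - a) - RLint (beta + 1) f t)) ->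
  - y b = c - RLint 1 f b ->
  (exists t, a < t <= b /\ y t <> 0) ->
  RLker beta (b - a) + RLker (beta + 1) (b - a) + 1 <
  (beta + (b - a)) * Gamma beta / Gamma (beta + 1) *
   ((RLker (beta + 1) (b - a) + 1) *
    RLint 1 ((fun s => `|p s| * RLker beta (s - a)) \_ (`]a, b[%classic)) b).
Proof.
move=> ab beta0 cp yi f yE ybE [t0 [t0ab yt0]].
have b10 : 0 < beta + 1 by rewrite addr_gt0.
have b11 : 1 <= beta + 1 by rewrite lerDr ltW.
set P := (X in RLint 1 X b).
have L0 : 0 < b - a by rewrite subr_gt0.
have Gb := Gamma_gt0 _ beta0. have Gb1 := Gamma_gt0 _ b10.
have ext (g : R -> R) : mu.-integrable `]a, b[ (EFin \o g) ->
    mu.-integrable setT (EFin \o (g \_ `]a, b[)).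
  move=> gi; rewrite -restrict_EFin; apply/integrable_restrict => //=; rewrite setTI.
  exact: gi.
have patch0 (g : R -> R) s : ~~ (a < s < b) -> (g \_ `]a, b[) s = 0.
  by move=> /negbTE sab; rewrite patchE mem_setE in_itv/= sab.
have RLi x g : 1 <= x -> mu.-integrable setT (EFin \o g) ->
    (forall s, ~~ (a < s < b) -> g s = 0) -> forall t, RL_integrable x t g.
  move=> x1 gi g0 t; apply: (RL_integrable_bounded _ a) => //.
  - by apply/measurable_EFinP; exact: measurable_int gi.
  - by move=> r ra; apply: g0; rewrite negb_and -leNgt ra.
  - exact: integrableS gi.
have fi : mu.-integrable setT (EFin \o f) by apply: ext; exact: integrable_mul_continuous.
have f0 := patch0 (fun s => p s * y s) : forall s, ~~ (a < s < b) -> f s = 0.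
pose nf s := `|f s|.
have nfi : mu.-integrable setT (EFin \o nf) by exact: integrable_norm.
have nf0 s : ~~ (a < s < b) -> nf s = 0 by move=> /f0 fs0; rewrite /nf fs0 normr0.
have Pi : mu.-integrable setT (EFin \o P).
  apply: ext.
  have Ki := RL_integrable1_integrable a b _ (RL_integrable_RLker 1 beta b a ltr01 beta0).
  have := integrable_norm (integrable_mul_continuous _ _ _ _ ab cp Ki).
  by apply: eq_integrable => // s _ /=; rewrite normrM (ger0_norm (RLker_ge0 _ _ beta0)).
have P0 := patch0 (fun s => `|p s| * RLker beta (s - a)) : forall s, ~~ (a < s < b) -> P s = 0.
have Pge0 s : 0 <= P s.
  have [sab|sab] := boolP (a < s < b); last by rewrite P0.
  by rewrite /P patchE mem_setE in_itv/= sab mulr_ge0// RLker_ge0.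
have fK := RLi _ _ b11 fi f0; have f1 := RLi _ _ (lexx 1) fi f0.
have nK := RLi _ _ b11 nfi nf0; have n1 := RLi _ _ (lexx 1) nfi nf0.
have PK := RLi _ _ b11 Pi P0; have P1 := RLi _ _ (lexx 1) Pi P0.
pose A x := RLker beta x + RLker (beta + 1) x.
have A_ge0 x : 0 <= A x by rewrite addr_ge0// RLker_ge0.
have AL0 : 0 < A (b - a) + 1 by rewrite ltr_wpDl.
pose T := RLint (beta + 1) nf b + RLint 1 nf b.
have T0 : 0 <= T.
  by apply: addr_ge0; apply: Rintegral_ge0 => s _; apply: mulr_ge0;
    first [exact: normr_ge0|exact: RLker_ge0].
pose D := T / (A (b - a) + 1).
have D0 : 0 <= D by rewrite divr_ge0// ltW.
(* The formula for y at t = b, inserted into the condition at b, is linear in c with coefficient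
   A(b) + 1 > 0. *)
have cE : c = (RLint (beta + 1) f b + RLint 1 f b) / (A (b - a) + 1).
  have E : c * (A (b - a) + 1) = RLint (beta + 1) f b + RLint 1 f b.
    have := ybE; rewrite yE ?ab ?lexx// => E.
    have -> : RLint 1 f b = c + (c * RLker beta (b - a) +
      (c * RLker (beta + 1) (b - a) - RLint (beta + 1) f b)).
      by rewrite -[LHS](subKr c) -E opprK.
    rewrite /A; move: (RLker beta _) (RLker (beta + 1) _) (RLint _ _ _) => u v w.
    by ring.
  by rewrite -E mulfK// gt_eqF.
have yA t : a < t <= b -> `|y t| <= A (t - a) * D.
  move=> tab; have /andP[a_t tb] := tab.
  pose k := A (t - a) / (A (b - a) + 1).
  have k0 : 0 <= k by rewrite divr_ge0// ltW.
  have -> : A (t - a) * D = k * T by rewrite /k /D mulrA mulrAC.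
  have -> : y t = k * RLint (beta + 1) f b + (k * RLint 1 f b - RLint (beta + 1) f t).
    rewrite yE// cE /k /A.
    move: (RLker beta (t - a)) (RLker (beta + 1) (t - a)) (RLker beta (b - a) + RLker (beta + 1) (b - a) + 1)^-1.
    move: (RLint (beta + 1) f b) (RLint 1 f b) (RLint (beta + 1) f t).
    by move=> *; ring.
  apply: (le_normr_RLint_comb _ a) => // s /andP[as_ sb].
  rewrite /k mulrAC ler_pdivlMr//.
  exact: green_kernel_ge0.
(* [kappa] is chosen so that A(s - a) <= kappa * RLker beta (s - a): the factor beta + (s - a) is
   replaced by its value at b, and [Gamma beta] undoes the normalisation of the kernel. *)
pose kappa := (beta + (b - a)) * Gamma beta / Gamma (beta + 1).
have kappa0 : 0 < kappa by rewrite divr_gt0// mulr_gt0// addr_gt0.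
have nfP s : nf s <= kappa * D * P s.
  have [sab|sab] := boolP (a < s < b); last by rewrite nf0// P0// mulr0.
  have /andP[as_ sb] := sab.
  rewrite /nf /f /P !patchE mem_setE in_itv/= sab normrM.
  rewrite mulrCA ler_wpM2l//.
  apply: (le_trans (yA s _)); first by rewrite as_ ltW.
  rewrite mulrAC; apply: ler_wpM2r => //.
  have x0 : 0 < s - a by rewrite subr_gt0.
  rewrite /A RLker_sum// /kappa RLkerE//.
  rewrite [leRHS](_ : _ = (s - a) `^ (beta - 1) * (beta + (b - a)) / Gamma (beta + 1)).
    apply: ler_wpM2r; first by rewrite invr_ge0 ltW.
    by apply: ler_wpM2l; [exact: powR_ge0|rewrite lerD2l lerB// ltW].
  move: (Gamma beta) (Gamma (beta + 1)) Gb Gb1 => G H G0 H0.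
  by field; rewrite !gt_eqF.
have Tpos : 0 < T.
  rewrite lt_neqAle T0 andbT eq_sym; apply/eqP => TE.
  apply: yt0; apply/eqP; rewrite -normr_le0 (le_trans (yA _ t0ab))//.
  by rewrite /D TE mul0r mulr0.
have Dpos : 0 < D by rewrite divr_gt0.
have FP : A (b - a) + 1 <= kappa * (RLint (beta + 1) P b + RLint 1 P b).
  rewrite -(ler_pM2r Dpos) [leLHS](_ : _ = T); last by rewrite /D mulrC divfK// gt_eqF.
  rewrite [leRHS](_ : _ = kappa * D * RLint (beta + 1) P b + kappa * D * RLint 1 P b); last first.
    by move: (RLint (beta + 1) P b) (RLint 1 P b) => *; ring.
  apply: lerD; [rewrite -(RLintZ _ _ (kappa * D) P (PK b))|rewrite -(RLintZ _ _ (kappa * D) P (P1 b))].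
    exact: (RLint_le _ _ _ _ b10 (nK b) (RL_integrableZ _ _ (kappa * D) P (PK b)) nfP).
  exact: (RLint_le _ _ _ _ ltr01 (n1 b) (RL_integrableZ _ _ (kappa * D) P (P1 b)) nfP).
apply: (le_lt_trans FP); rewrite ltr_pM2l// mulrDl mul1r ltrD2r.
(* [E] is the loss in replacing Q(s) by Q(a): on ]a, b[ it is P(s) times the positive factor Q(a) -
   Q(s). *)
pose E s := RLker (beta + 1) (b - a) * (RLker 1 (b - s) * P s) - RLker (beta + 1) (b - s) * P s.
have PZ := integrableZl measurableT (RLker (beta + 1) (b - a)) (P1 b).
have Ei : mu.-integrable setT (EFin \o E) := integrableB measurableT PZ (PK b).
have EE s : a < s < b -> E s = (RLker (beta + 1) (b - a) - RLker (beta + 1) (b - s)) * P s.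
  by move=> /andP[_ sb]; rewrite /E RLker1 subr_gt0 sb mul1r mulrBl.
have Kpos s : a < s < b -> 0 < RLker (beta + 1) (b - a) - RLker (beta + 1) (b - s).
  by move=> /andP[as_ sb]; rewrite subr_gt0 RLker_lt ?subr_gt0// ltrD2l ltrN2.
have E0 s : 0 <= E s.
  have [sab|/P0 Ps] := boolP (a < s < b); last first.
    by rewrite [E s](_ : _ = 0)// /E Ps !mulr0 subrr.
  by rewrite EE// mulr_ge0// ltW// Kpos.
have intE : \int[mu]_s E s = RLker (beta + 1) (b - a) * RLint 1 P b - RLint (beta + 1) P b.
  rewrite (RintegralB measurableT PZ (PK b)).
  by rewrite (RintegralZl _ measurableT (P1 b)).
(* A zero loss would force P = 0 almost everywhere; by [nfP] then p y = 0 almost everywhere and T =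
   0, against [Tpos]. *)
rewrite -subr_gt0 -intE lt_neqAle Rintegral_ge0// andbT eq_sym; apply/eqP => intE0.
have aeE : ae_eq mu setT (EFin \o E) (cst 0%E).
  apply/(ae_eq_integral_abs mu measurableT (measurable_int _ Ei)).
  transitivity (\int[mu]_s (E s)%:E)%E.
    by apply: eq_integral => s _; rewrite gee0_abs// lee_fin.
  have := integrable_fin_num measurableT Ei => /fineK <-.
  exact: (congr1 EFin intE0).
have nf_ae : {ae mu, forall s, nf s = 0}.
  apply: filterS aeE => s /(_ I) /= [Es0].
  have [sab|sab] := boolP (a < s < b); last exact: nf0.
  have Ps0 : P s = 0.
    move: Es0 => /eqP; rewrite EE// mulf_eq0 gt_eqF ?Kpos//= => /eqP.
    exact.
  by apply/eqP; rewrite eq_le normr_ge0 (le_trans (nfP s))// Ps0 mulr0.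
have I0 x : RL_integrable x b nf -> RLint x nf b = 0.
  move=> ni; rewrite /RLint /Rintegral.
  have z : ae_eq mu setT (fun s : R => (RLker x (b - s) * nf s)%:E) (cst 0%E).
    move: nf_ae; apply: filterS; first exact: (ae_filter_ringOfSetsType mu).
    by move=> s ns0 _ /=; rewrite ns0 mulr0.
  have -> : (\int[mu]_s (RLker x (b - s) * nf s)%:E = \int[mu]_s cst 0 s)%E.
    by apply: ae_eq_integral => //; exact: measurable_int ni.
  by rewrite integral0.
by move: Tpos; rewrite /T !I0// addr0 ltxx.
Qed.

End lyapunov.

Theorem theorem3p5 (R : realType) (a b alpha : R) (p : R -> R)
    (hab : a < b) (halpha1 : 1 < alpha) (halpha2 : alpha <= 2)
    (hp : {within `[a, b], continuous p})
    (hsol : exists y : R -> R, is_solution a b alpha p y /\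
       exists t : R, t \in `]a, b] /\ y t <> 0) :
  \int[lebesgue_measure]_(s in `[a, b]) ((s - a) `^ (alpha - 2) * `|p s|) >
  (((b - a) `^ (alpha - 1) + (alpha - 1) * (b - a) `^ (alpha - 2)
      + Gamma alpha) * Gamma alpha) /
  (((b - a) `^ (alpha - 1) + Gamma alpha) * (b - a + alpha - 1)).
Proof.
have [y [sol [t0 [t0ab yt0]]]] := hsol.
have beta0 : 0 < alpha - 1 by rewrite subr_gt0.
have L0 : 0 < b - a by rewrite subr_gt0.
have Gb := Gamma_gt0 _ beta0.
have Ga : 0 < Gamma alpha by apply: Gamma_gt0; exact: lt_trans halpha1.
have [c [yE ybE]] := solution_representation a b alpha p y hab halpha1 halpha2 hp sol.
have := lyapunov_bound a b (alpha - 1) p y c hab beta0 hp (sol_integrable sol).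
rewrite /= !subrK => /(_ yE ybE); set P := (X in RLint 1 X b) => H.
have : exists t, a < t <= b /\ y t <> 0.
  by exists t0; split => //; move: t0ab; rewrite in_itv.
move=> /H {H}.
(* The closed interval is reduced to the open one, its endpoints being null, because the power form
   of the kernel holds for s > a. *)
have IE : RLint 1 P b = (Gamma (alpha - 1))^-1 *
    \int[lebesgue_measure]_(s in `[a, b]) ((s - a) `^ (alpha - 2) * `|p s|).
  have mp : measurable_fun `]a, b[ p.
    apply: open_continuous_measurable_fun; first exact: interval_open.
    have /(continuous_within_itvP _ hab)[cpi _ _] := hp.
    by move=> t; rewrite inE; exact: cpi.
  have mq : measurable_fun `]a, b[ (fun s : R => (s - a) `^ (alpha - 2) * `|p s|).
    apply: measurable_funM; last exact: measurableT_comp.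
    apply: (measurableT_comp (measurable_powR _)).
    by apply: measurable_funB => //; exact: measurable_cst.
  have mP : measurable_fun setT P.
    apply/(measurable_restrictT (fun s => `|p s| * RLker (alpha - 1) (s - a))) => //.
    apply: measurable_funM.
      exact: measurableT_comp.
    by apply: measurable_funTS; apply: measurable_RLker_comp; exact: measurable_funB.
  rewrite (RLint1E a)//; last first.
    by move=> r ra; rewrite /P patchE mem_setE in_itv/= ltNge ra.
  rewrite /Rintegral [in RHS]integral_itv_bndoo; last exact/measurable_EFinP.
  rewrite [in LHS]integral_itv_bndoo; last first.
    by apply/measurable_EFinP; exact: measurable_funTS.
  rewrite -!/(Rintegral _ _ _) -Rintegral_pZl//; last by rewrite invr_ge0 ltW.
  apply: eq_Rintegral => s sab; rewrite /P /patch sab RLkerE; last first.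
    by move: sab; rewrite inE/= in_itv/= subr_gt0 => /andP[].
  rewrite (_ : alpha - 1 - 1 = alpha - 2); last by ring.
  by rewrite mulrC mulrAC mulrC mulrA.
rewrite IE; set I := \int[_]_(s in _) _.
have K1 : RLker alpha (b - a) = (b - a) `^ (alpha - 1) / Gamma alpha by exact: RLkerE.
have K2 : RLker (alpha - 1) (b - a) + RLker alpha (b - a) =
    (b - a) `^ (alpha - 2) * (alpha - 1 + (b - a)) / Gamma alpha.
  have := RLker_sum _ _ beta0 L0; rewrite subrK => ->.
  by rewrite (_ : alpha - 1 - 1 = alpha - 2); last by ring.
have K3 : (b - a) `^ (alpha - 1) = (b - a) * (b - a) `^ (alpha - 2).
  rewrite -(mulr_powRB1 (ltW L0) beta0).
  by rewrite (_ : alpha - 1 - 1 = alpha - 2); last by ring.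
rewrite K2 K1 K3.
have W0 : 0 < (b - a) `^ (alpha - 2) by exact: powR_gt0.
move: Ga Gb W0 beta0 L0; rewrite (_ : b - a + alpha - 1 = b - a + (alpha - 1)); last by ring.
move: (alpha - 1) (b - a) I ((b - a) `^ (alpha - 2)) (Gamma (alpha - 1)) (Gamma alpha).
move=> be L J W B G G0 B0 W0 be0 L0 H.
rewrite ltr_pdivrMr; last by rewrite mulr_gt0// addr_gt0// mulr_gt0.
(* Multiplying by Gamma(alpha)^2 clears the denominators; the [Gamma (alpha - 1)] in kappa cancels
   the one coming from [IE]. *)
have GG0 : 0 < G * G by rewrite mulr_gt0.
have := H; rewrite -(ltr_pM2r GG0).
rewrite [X in X < _](_ : _ = (L * W + be * W + G) * G); last by field; rewrite gt_eqF.
rewrite [X in _ < X](_ : _ = J * ((L * W + G) * (L + be)))//.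
by field; rewrite !gt_eqF.
Qed.
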